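(* (General Representation Formula) Let $D\subseteq\mathbb{C}\times\mathbb{R}$ be invariant under $(z,\beta)\mapsto(z,-\beta)$, assume $\Omega:=\Omega_D$ to be a $(1,3)$-slice domain and let $f:\Omega\to\mathbb{H}$ be a $(1,3)$-regular function. For all $I,J,K\in\mathbb{S}^1$ with $J\neq K$ and for all $z+\beta I\in\Omega$ (with $z\in\mathbb{C},\beta\in\mathbb{R}$), $$\begin{aligned}f(z+\beta I)&=(J-K)^{-1}\big(Jf(z+\beta J)-Kf(z+\beta K)\big)+I(J-K)^{-1}\big(f(z+\beta J)-f(z+\beta K)\big)\\&=\big((J-K)^{-1}J+I(J-K)^{-1}\big)f(z+\beta J)-\big((J-K)^{-1}K+I(J-K)^{-1}\big)f(z+\beta K)\,.\end{aligned}$$ In particular, for all $I,J\in\mathbb{S}^1$ and all $z+\beta I\in\Omega$, $$\begin{aligned}f(z+\beta I)&=\tfrac12\big(f(z+\beta J)+f(z-\beta J)\big)+I\tfrac{J}{2}\big(f(z-\beta J)-f(z+\beta J)\big)\\&=\tfrac{1-IJ}{2}f(z+\beta J)+\tfrac{1+IJ}{2}f(z-\beta J)\,.\end{aligned}$$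
   Context: $\mathbb{H}=\mathbb{R}+i\mathbb{R}+j\mathbb{R}+k\mathbb{R}$ is the algebra of real quaternions; $\mathbb{C}:=\mathbb{R}+i\mathbb{R}\subset\mathbb{H}$; $\mathbb{S}^1:=\{jb+kc: b,c\in\mathbb{R},\ b^2+c^2=1\}$. For $J\in\mathbb{S}^1$, $\mathbb{R}^{2+1}_J:=\mathrm{Span}_{\mathbb{R}}(1,i,J)$, with points written $x_0+ix_1+\beta J$ ($x_0,x_1,\beta\in\mathbb{R}$). For $V\subseteq\mathbb{R}^{2+1}_J$ open, a $C^1$ function $\phi:V\to\mathbb{H}$ is $J$-monogenic if $(\partial_{x_0}+i\partial_{x_1}+J\partial_\beta)\phi(x_0+ix_1+\beta J)\equiv0$ on $V$ (left multiplication). A domain $\Omega$ in $\mathbb{H}$ is a nonempty connected open subset; $\Omega_J:=\Omega\cap\mathbb{R}^{2+1}_J$ and, for $f:\Omega\to\mathbb{H}$, $f_J:=f|_{\Omega_J}$. The function $f$ is $(1,3)$-regular if $f_J$ is $J$-monogenic for every $J\in\mathbb{S}^1$. A domain $\Omega$ is a $(1,3)$-slice domain if $\Omega\cap\mathbb{C}\neq\emptyset$ and $\Omega_J$ is connected for every $J\in\mathbb{S}^1$. For $D\subseteq\mathbb{C}\times\mathbb{R}$, $\Omega_D:=\{z+\beta J:(z,\beta)\in D,\ J\in\mathbb{S}^1\}\subseteq\mathbb{H}$. *)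

(* Defs.v *)
From HB Require Import structures.
From mathcomp Require Import all_boot all_order all_algebra.
From mathcomp Require Import all_classical all_reals all_analysis.
From mathcomp Require Import ring lra.

Set Implicit Arguments.
Unset Strict Implicit.
Unset Printing Implicit Defensive.

Import Order.TTheory GRing.Theory Num.Theory.
Import numFieldNormedType.Exports.

Local Open Scope classical_set_scope.
Local Open Scope ring_scope.

(* [quat R] inherits from 'rV[R]_4 its real vector space structure and the
   topology of R^4; the norm it inherits is the sup norm, not the Euclidean
   one.  The product below is the Hamilton product, so that [quat R] is the
   division algebra of real quaternions. *)
Definition quat (R : realType) : Type := 'rV[R]_4.

HB.instance Definition _ (R : realType) :=
  NormedModule.copy (quat R) 'rV[R]_4.

Section QuaternionAlgebra.
Variable R : realType.
Implicit Types (x y z : quat R) (a : R).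

Definition mkquat (a b c d : R) : quat R := \row_(n < 4) [:: a; b; c; d]`_n.

Definition re x : R := x ord0 (inord 0).
Definition im_i x : R := x ord0 (inord 1).
Definition im_j x : R := x ord0 (inord 2).
Definition im_k x : R := x ord0 (inord 3).

Lemma quatP x y : re x = re y -> im_i x = im_i y -> im_j x = im_j y ->
  im_k x = im_k y -> x = y.
Proof.
move=> h0 h1 h2 h3; apply/rowP => n.
have nE : n = inord n by rewrite inord_val.
by rewrite nE; case: n {nE} => -[|[|[|[|//]]]].
Qed.

Lemma reE a b c d : re (mkquat a b c d) = a.
Proof. by rewrite /re mxE inordK. Qed.
Lemma im_iE a b c d : im_i (mkquat a b c d) = b.
Proof. by rewrite /im_i mxE inordK. Qed.
Lemma im_jE a b c d : im_j (mkquat a b c d) = c.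
Proof. by rewrite /im_j mxE inordK. Qed.
Lemma im_kE a b c d : im_k (mkquat a b c d) = d.
Proof. by rewrite /im_k mxE inordK. Qed.

Lemma reD x y : re (x + y) = re x + re y. Proof. exact: mxE. Qed.
Lemma im_iD x y : im_i (x + y) = im_i x + im_i y. Proof. exact: mxE. Qed.
Lemma im_jD x y : im_j (x + y) = im_j x + im_j y. Proof. exact: mxE. Qed.
Lemma im_kD x y : im_k (x + y) = im_k x + im_k y. Proof. exact: mxE. Qed.

Lemma reZ a x : re (a *: x) = a * re x. Proof. exact: mxE. Qed.
Lemma im_iZ a x : im_i (a *: x) = a * im_i x. Proof. exact: mxE. Qed.
Lemma im_jZ a x : im_j (a *: x) = a * im_j x. Proof. exact: mxE. Qed.
Lemma im_kZ a x : im_k (a *: x) = a * im_k x. Proof. exact: mxE. Qed.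

Lemma re0 : re 0 = 0. Proof. exact: mxE. Qed.
Lemma im_i0 : im_i 0 = 0. Proof. exact: mxE. Qed.
Lemma im_j0 : im_j 0 = 0. Proof. exact: mxE. Qed.
Lemma im_k0 : im_k 0 = 0. Proof. exact: mxE. Qed.

Definition mulq x y : quat R :=
  mkquat
    (re x * re y - im_i x * im_i y - im_j x * im_j y - im_k x * im_k y)
    (re x * im_i y + im_i x * re y + im_j x * im_k y - im_k x * im_j y)
    (re x * im_j y - im_i x * im_k y + im_j x * re y + im_k x * im_i y)
    (re x * im_k y + im_i x * im_j y - im_j x * im_i y + im_k x * re y).

Definition sqnormq x : R :=
  re x ^+ 2 + im_i x ^+ 2 + im_j x ^+ 2 + im_k x ^+ 2.

Definition conjq x : quat R := mkquat (re x) (- im_i x) (- im_j x) (- im_k x).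

Definition invq x : quat R := (sqnormq x)^-1 *: conjq x.

Definition quatE := (reE, im_iE, im_jE, im_kE, reD, im_iD, im_jD, im_kD,
  reZ, im_iZ, im_jZ, im_kZ, re0, im_i0, im_j0, im_k0).

Fact mulqA : associative mulq.
Proof. by move=> x y z; apply: quatP; rewrite !quatE; ring. Qed.

Fact mul1q : left_id (mkquat 1 0 0 0) mulq.
Proof. by move=> x; apply: quatP; rewrite !quatE; ring. Qed.

Fact mulq1 : right_id (mkquat 1 0 0 0) mulq.
Proof. by move=> x; apply: quatP; rewrite !quatE; ring. Qed.

Fact mulqDl : left_distributive mulq +%R.
Proof. by move=> x y z; apply: quatP; rewrite !quatE; ring. Qed.

Fact mulqDr : right_distributive mulq +%R.
Proof. by move=> x y z; apply: quatP; rewrite !quatE; ring. Qed.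

Fact oneq_neq0 : mkquat 1 0 0 0 != 0 :> quat R.
Proof.
by apply/eqP => /(congr1 re); rewrite reE re0 => /eqP; rewrite oner_eq0.
Qed.

HB.instance Definition _ := GRing.Zmodule_isNzRing.Build (quat R)
  mulqA mul1q mulq1 mulqDl mulqDr oneq_neq0.

Fact scaleqAl a x y : a *: (x * y) = (a *: x) * y.
Proof. by apply: quatP; rewrite !quatE; ring. Qed.

HB.instance Definition _ := GRing.Lmodule_isLalgebra.Build R (quat R) scaleqAl.

Fact scaleqAr a x y : a *: (x * y) = x * (a *: y).
Proof. by apply: quatP; rewrite !quatE; ring. Qed.

HB.instance Definition _ := GRing.Lalgebra_isAlgebra.Build R (quat R) scaleqAr.

Lemma sqnormq_eq0 x : sqnormq x = 0 -> x = 0.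
Proof.
rewrite /sqnormq => /eqP.
rewrite !paddr_eq0 ?addr_ge0 ?sqr_ge0// !sqrf_eq0.
move=> /andP[/andP[/andP[/eqP h0 /eqP h1] /eqP h2] /eqP h3].
by apply: quatP; rewrite !quatE.
Qed.

Lemma invq0 : invq 0 = 0.
Proof. by apply: quatP; rewrite !quatE ?oppr0 mulr0. Qed.

Fact mulVq : {in [pred x | x != 0], left_inverse 1 invq *%R}.
Proof.
move=> x; rewrite inE => x0.
have n0 : sqnormq x != 0 by apply: contra_neq x0; exact: sqnormq_eq0.
by apply: quatP; rewrite !quatE; rewrite /sqnormq in n0 *; field.
Qed.

Fact mulqV : {in [pred x | x != 0], right_inverse 1 invq *%R}.
Proof.
move=> x; rewrite inE => x0.
have n0 : sqnormq x != 0 by apply: contra_neq x0; exact: sqnormq_eq0.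
by apply: quatP; rewrite !quatE; rewrite /sqnormq in n0 *; field.
Qed.

Fact unitqP x y : y * x = 1 /\ x * y = 1 -> x \in [pred x | x != 0].
Proof.
by case=> + _; rewrite inE; apply: contra_eq_neq => ->; rewrite mulr0 eq_sym oner_eq0.
Qed.

Fact invq_out : {in [predC [pred x | x != 0]], invq =1 id}.
Proof. by move=> x; rewrite !inE negbK => /eqP ->; exact: invq0. Qed.

HB.instance Definition _ := GRing.NzRing_hasMulInverse.Build (quat R)
  mulVq mulqV unitqP invq_out.

Definition qi : quat R := mkquat 0 1 0 0.
Definition qj : quat R := mkquat 0 0 1 0.
Definition qk : quat R := mkquat 0 0 0 1.

End QuaternionAlgebra.

Arguments qi {R}.
Arguments qj {R}.
Arguments qk {R}.

Section Regularity.
Variable R : realType.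
Implicit Types (J : quat R) (V Omega : set (quat R)) (f : quat R -> quat R).

Definition complexes : set (quat R) :=
  [set q | exists a b : R, q = a%:A + b *: qi].

Definition S1 : set (quat R) :=
  [set q | exists b c : R, b ^+ 2 + c ^+ 2 = 1 /\ q = b *: qj + c *: qk].

Definition R21 J : set (quat R) :=
  [set q | exists x0 x1 beta : R, q = x0%:A + x1 *: qi + beta *: J].

Definition slice Omega J : set (quat R) := Omega `&` R21 J.

(* A function on a subset of the quaternions is represented by a total one.
   For V a relatively open subset of [R21 J], the partial derivatives with
   respect to x0, x1, beta at a point of V are the directional derivatives
   along 1, i, J.  These directions lie in [R21 J], so they, and the continuity
   within V, only depend on the values of f on V. *)
Definition C1_on J V f : Prop :=
  forall v, [set 1; qi; J] v ->
    (forall x, V x -> derivable f x v) /\ {within V, continuous ('D_v f)}.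

Definition monogenic J V f : Prop :=
  C1_on J V f /\
  forall x, V x -> 'D_1 f x + qi * 'D_qi f x + J * 'D_J f x = 0.

Definition regular13 Omega f : Prop :=
  forall J, S1 J -> monogenic J (slice Omega J) f.

Definition is_domain Omega : Prop :=
  [/\ Omega !=set0, connected Omega & open Omega].

Definition slice_domain13 Omega : Prop :=
  [/\ is_domain Omega, Omega `&` complexes !=set0 &
      forall J, S1 J -> connected (slice Omega J)].

Definition OmegaD (D : set (quat R * R)) : set (quat R) :=
  [set q | exists z beta J, [/\ D (z, beta), S1 J & q = z + beta *: J]].

End Regularity.

Arguments complexes {R}.
Arguments S1 {R}.

(* Main.v *)
From HB Require Import structures.
Require Import Defs.
From mathcomp Require Import all_boot all_order all_algebra.
From mathcomp Require Import all_classical all_reals all_analysis.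
From mathcomp Require Import ring lra.
Import Order.TTheory GRing.Theory Num.Theory.
Import numFieldNormedType.Exports.

Set Implicit Arguments.
Unset Strict Implicit.
Unset Printing Implicit Defensive.

Local Open Scope classical_set_scope.
Local Open Scope ring_scope.

(** The coordinates (x0, x1, beta) identify all the slices of OmegaD D with the same
    connected open set V of R^3, which meets the plane beta = 0.  Fix I, J, K and
    put A = (J - K)^-1.  The elements J, K and A anticommute with i, so
    P = A J + I A commutes with i, and I P = P J because the squares of I and J
    are -1.  Hence left multiplication by P turns a solution of the equation
    (d0 + i d1 + J d2) u = 0 into a solution of (d0 + i d1 + I d2) u = 0
    ([slice_transfer]), and in the same way for Q = A K + I A and K.  So the
    difference g of f(z + beta I) and P f(z + beta J) - Q f(z + beta K) solves the
    equation for I on V.  For beta = 0 it vanishes since P - Q = A (J - K) = 1, and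
    the identity principle [monogenic_identity] gives g = 0.  The second formula is
    the case K = - J.

    The identity principle says that a C1 solution on a connected open set which
    vanishes on its nonempty intersection with the plane is zero.  It is proved by a
    Carleman estimate, without regularity theory.  Let E be the Euler field, s the
    squared distance to the origin and x = x0 + i x1 + I x2.  Then the conjugate of x
    times the Dirac operator is E + Gamma, where Gamma involves only rotation fields
    ([euler_rotation_split]).  In the L2 space of R^3 the operator E + 3/2 is
    antisymmetric, Gamma - 3/2 is symmetric, and they commute.  For a radial function
    k and a compactly supported v this gives
      || (E + Gamma - k) v ||^2 >= integral of (E k) |v|^2.
    It is applied to v = exp (tau / (s + eta)) chi u, with chi a radial cutoff and k
    the derivative of tau / (s + eta) along E, which is increasing in s when s > eta.
    If u vanishes for s <= 2 eta, letting tau tend to infinity shows that u vanishes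
    in the whole ball ([monogenic_ball_unique]).  This makes the interior of the zero
    set relatively closed.  It is nonempty because extending u by zero across the
    plane produces a C1 solution ([monogenic_zero_on_plane]).

    Integration by parts is done on Riemann sums over a periodic grid.  The
    commutation of E and Gamma amounts to the vanishing of the integrals of the null
    Lagrangians d_a p d_b q - d_b p d_a q.  Their discrete analogue is an exact
    identity ([discrete_null_lagrangian]), so second derivatives never occur. *)

(** * Directional derivatives *)

Section DirectionalCalculus.
Variable R : realType.

Lemma is_derive_line (V W : normedModType R) (f : V -> W) (x v : V) (s : R) :
  derivable f (x + s *: v) v ->
  is_derive s 1 (fun t : R => f (x + t *: v)) ('D_v f (x + s *: v)).
Proof.
have E : (fun h : R => h^-1 *: (((fun t : R => f (x + t *: v)) \o shift s)
     (h *: (1 : R)) - f (x + s *: v))) =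
   (fun h => h^-1 *: ((f \o shift (x + s *: v)) (h *: v) - f (x + s *: v))).
  apply/funext => h /=; congr (_ *: (f _ - _)).
  by rewrite scalerDl addrCA [h *: 1]mulr1.
move=> df; apply: DeriveDef; first by rewrite /derivable E.
by rewrite /derive E.
Qed.

(** The intermediate point is given as a fraction t of the step, so that one
    statement covers steps of both signs and the zero step. *)
Lemma mvt_direction (V : normedModType R) (f : V -> R) (x v : V) (h : R) :
  (forall t : R, 0 <= t <= 1 -> derivable f (x + (t * h) *: v) v) ->
  exists2 t : R, 0 <= t <= 1 &
    f (x + h *: v) - f x = h * 'D_v f (x + (t * h) *: v).
Proof.
move=> df.
pose g (t : R) : R := f (x + (t * h) *: v).
have dg (t : R) : 0 <= t <= 1 ->
    is_derive t 1 g ('D_v f (x + (t * h) *: v) * h).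
  move=> t01; have H := is_derive_line (df _ t01).
  have Hm : is_derive t 1 (fun t : R => t * h) h.
    have -> : (fun t : R => t * h) = h \*: (@id R).
      by apply/funext => z /=; rewrite mulrC.
    by apply: is_derive_eq; rewrite [_ *: _]mulr1.
  exact: (@is_derive1_comp _ _ (fun t : R => t * h)).
have cg : {within `[0, 1], continuous g}.
  apply: derivable_within_continuous => t; rewrite in_itv/= => /dg [] //.
have [|t tI E] := @MVT_segment R g (fun t => 'D_v f (x + (t * h) *: v) * h) 0 1 ler01 _ cg.
  by move=> t; rewrite in_itv/= => /andP[t0 t1]; apply: dg; rewrite !ltW.
exists t; first by move: tI; rewrite in_itv.
move: E; rewrite /g mul1r mul0r scale0r addr0 => ->.
by rewrite subr0 mulr1 mulrC.
Qed.

(** On the line through x in direction v this is the one-dimensional chain rule;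
    of f only the derivative along that line is assumed to exist. *)
Lemma is_derive_comp1 (V : normedModType R) (k : R -> R) (f : V -> R) (x v : V)
    (dk df : R) :
  is_derive (f x) 1 k dk -> is_derive x v f df ->
  is_derive x v (k \o f) (dk * df).
Proof.
move=> Hk [Hf <-].
have Hf' : derivable f (x + 0 *: v) v by rewrite scale0r addr0.
have := is_derive_line Hf'; rewrite scale0r addr0 => Hl.
have Hk' : is_derive ((fun t : R => f (x + t *: v)) 0) 1 k dk.
  by rewrite scale0r addr0.
have [D E] := @is_derive1_comp _ _ (fun t : R => f (x + t *: v)) 0 _ _ Hk' Hl.
have E2 : (fun h : R => h^-1 *: (((k \o (fun t : R => f (x + t *: v))) \o shift 0)
     (h *: (1 : R)) - (k \o (fun t : R => f (x + t *: v))) 0)) =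
   (fun h => h^-1 *: (((k \o f) \o shift x) (h *: v) - (k \o f) x)).
  apply/funext => h /=; rewrite addr0 scale0r addr0 [h *: 1]mulr1.
  by rewrite [x + _]addrC.
apply: DeriveDef; first by move: D; rewrite /derivable E2.
by move: E; rewrite /derive E2.
Qed.

Lemma continuous_ballP (V W : normedModType R) (f : V -> W) (x : V) :
  {for x, continuous f} <->
  forall eps, 0 < eps -> exists2 d, 0 < d &
    forall y, `|x - y| < d -> `|f x - f y| <= eps.
Proof.
split.
  move=> /cvgrPdist_le cf eps eps0; have /nbhs_ballP[d d0 Hd] := cf eps eps0.
  by exists d => // y xy; apply: Hd; rewrite -ball_normE.
move=> H; apply/cvgrPdist_le => eps eps0; have [d d0 Hd] := H eps eps0.
by apply/nbhs_ballP; exists d => //= y; rewrite -ball_normE; exact: Hd.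
Qed.

Lemma nbhs_normP (V : normedModType R) (P : set V) (x : V) :
  nbhs x P <-> exists2 d : R, 0 < d & forall y, `|x - y| < d -> P y.
Proof.
split=> [/nbhs_ballP[d /= d0 Hd]|[d d0 Hd]].
  by exists d => // y xy; apply: Hd; rewrite -ball_normE.
by apply/nbhs_ballP; exists d => //= y; rewrite -ball_normE; exact: Hd.
Qed.

End DirectionalCalculus.

(** * Continuously differentiable functions on R^n *)

Section C1Functions.
Variables (R : realType) (n : nat).
Local Notation T := 'rV[R]_n.
Local Notation e a := (delta_mx 0 a : 'rV[R]_n).

(** The set V is meant to be open.  The directional derivatives are total
    functions, and continuity at the points of V is continuity in the ambient
    space; in this way C1 on two sets is C1 on their union. *)
Definition C1 (W : normedModType R) (V : set T) (p : T -> W) :=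
  forall a x, V x -> derivable p x (e a) /\ {for x, continuous ('D_(e a) p)}.

Lemma near_continuous (U W : topologicalType) (f g : U -> W) (x : U) :
  (\near x, f x = g x) -> {for x, continuous g} -> {for x, continuous f}.
Proof.
move=> fg cg; have fgx := nbhs_singleton fg.
rewrite /prop_for /continuous_at fgx.
by apply: cvg_trans cg; apply: near_eq_cvg; apply: filterS fg => y ->.
Qed.

Lemma C1I (W : normedModType R) (V : set T) (p : T -> W) (dp : 'I_n -> T -> W) :
  open V ->
  (forall a x, V x -> is_derive x (e a) p (dp a x)) ->
  (forall a x, V x -> {for x, continuous (dp a)}) -> C1 V p.
Proof.
move=> oV Hd Hc a x Vx; split; first by have [] := Hd a x Vx.
apply: near_continuous (Hc a x Vx).
have : nbhs x V by exact: open_nbhs_nbhs.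
by apply: filterS => y Vy; have [] := Hd a y Vy.
Qed.

Lemma norm_coord (x : T) a : `|x 0 a| <= `|x|.
Proof.
by rewrite [leRHS]/Num.Def.normr/= mx_normrE; apply: (le_bigmax _ _ (0, a)).
Qed.

Lemma norm_rV_le (x : T) (r : R) : 0 <= r -> (forall a, `|x 0 a| <= r) -> `|x| <= r.
Proof.
move=> r0 H; rewrite /Num.Def.normr/= mx_normrE.
by apply: bigmax_le => // -[i j] _; rewrite (ord1 i)/=; exact: H.
Qed.

Lemma norm_scale_delta (t : R) (a : 'I_n) : `|t *: e a| = `|t|.
Proof.
apply/eqP; rewrite eq_le; apply/andP; split.
  apply: norm_rV_le => // b; rewrite !mxE eqxx/=.
  by case: (b == a); rewrite ?mulr1// mulr0 normr0.
by have := norm_coord (t *: e a) a; rewrite !mxE !eqxx mulr1.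
Qed.

(** The coordinates are changed one at a time; each change costs at most a bound
    of the derivatives near x times the size of the change, so p is Lipschitz
    at x. *)
Lemma C1_continuous (V : set T) (p : T -> R) : open V -> C1 V p ->
  forall x, V x -> {for x, continuous p}.
Proof.
move=> oV Cp x Vx.
have [r0 r00 Br0] : exists2 r, 0 < r & forall y, `|x - y| < r -> V y.
  by apply/nbhs_normP; exact: open_nbhs_nbhs.
have [C [C0 [r1 r10 Br1]]] : exists C : R, 0 <= C /\ exists2 r, 0 < r &
    forall y, `|x - y| < r -> forall a, `|'D_(e a) p y| <= C.
  exists (1 + \sum_a `|'D_(e a) p x|); split.
    by rewrite addr_ge0// sumr_ge0.
  have : \forall y \near x, forall a, `|'D_(e a) p x - 'D_(e a) p y| <= 1.
    have H a : \forall y \near x, `|'D_(e a) p x - 'D_(e a) p y| <= 1.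
      have [_ ca] := Cp a x Vx.
      by move/cvgrPdist_le : ca => /(_ 1 ltr01).
    exact: (@filter_forall T 'I_n (fun a y => `|'D_(e a) p x - 'D_(e a) p y| <= 1) (nbhs x) _ H).
  move=> /nbhs_normP[r rp Br]; exists r => // y xy a.
  have {}Br := Br y xy a.
  have H1 : `|'D_(e a) p x| <= \sum_a `|'D_(e a) p x|.
    by rewrite (bigD1 a)//= lerDl; apply: sumr_ge0.
  have := ler_distD ('D_(e a) p x) ('D_(e a) p y) 0.
  by rewrite !subr0 distrC; lra.
pose r := Num.min r0 r1.
have rp : 0 < r by rewrite lt_min r00.
have Lip y : `|x - y| < r -> `|p y - p x| <= n%:R * (C * `|x - y|).
  move=> xy.
  (* z k has the first k coordinates of y and the remaining ones of x. *)
  pose z k : T := \row_a (if (a < k)%N then y 0 a else x 0 a).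
  have zin k t b : 0 <= t <= 1 ->
      `|x - (z k + (t * (y 0 b - x 0 b)) *: e b *+ (b == k :> nat))| < r.
    move=> t01; apply: le_lt_trans xy; apply: norm_rV_le => // a.
    rewrite !mxE; have := norm_coord (x - y) a; rewrite !mxE => H.
    case: (ltnP a k) => ak.
      case: eqP => [bk|_]; rewrite ?mulr0n ?mxE ?addr0 ?subr0//.
      have -> : (a == b) = false by apply/eqP => ab; rewrite ab bk ltnn in ak.
      by rewrite andbF mulr0 addr0.
    case: eqP => [bk|_]; rewrite ?mulr0n ?mulr1n ?mxE ?addr0 ?subrr ?normr0//.
    case: (eqVneq a b) => [ab|_]; rewrite ?andbF/= ?mulr0 ?addr0 ?subrr ?normr0//.
    rewrite ?eqxx /= opprD addNKr mulr1 -ab normrN normrM distrC.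
    apply: le_trans H; apply: ler_piMl => //.
    by case/andP: t01 => t0 t1; rewrite ger0_norm.
  have step k : (k < n)%N -> `|p (z k.+1) - p (z k)| <= C * `|x - y|.
    move=> kn; pose b := Ordinal kn.
    have Ez : z k.+1 = z k + (y 0 b - x 0 b) *: e b.
      apply/rowP => a; rewrite !mxE ltnS leq_eqVlt.
      have -> : (a == k :> nat) = (a == b) by [].
      case: (eqVneq a b) => [->|_]; last by rewrite andbF mulr0 addr0.
      by rewrite !eqxx ltnn mulr1 addrC subrK.
    have Hin t : 0 <= t <= 1 -> `|x - (z k + (t * (y 0 b - x 0 b)) *: e b)| < r.
      by move=> /(zin k t b); rewrite eqxx mulr1n.
    have [|t t01 E] := @mvt_direction R T p (z k) (e b) (y 0 b - x 0 b).
      move=> t /Hin H; have [] // := Cp b (z k + (t * (y 0 b - x 0 b)) *: e b).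
      by apply: Br0; apply: lt_le_trans H _; rewrite ge_min lexx.
    rewrite Ez E normrM mulrC; apply: ler_pM => //.
      by apply: Br1; apply: lt_le_trans (Hin t t01) _; rewrite ge_min lexx orbT.
    by rewrite distrC; have := norm_coord (x - y) b; rewrite !mxE.
  have Hk k : (k <= n)%N -> `|p (z k) - p x| <= k%:R * (C * `|x - y|).
    elim: k => [_|k IH kn].
      have -> : z 0%N = x by apply/rowP => a; rewrite mxE.
      by rewrite subrr normr0 mul0r.
    have := step k kn; have := IH (ltnW kn).
    have := ler_distD (p (z k)) (p (z k.+1)) (p x).
    by rewrite -natr1; lra.
  have := Hk n (leqnn _).
  by have -> : z n = y by apply/rowP => a; rewrite mxE ltn_ord.
apply/continuous_ballP => eps eps0.
have nC0 : 0 < n%:R * C + 1 by rewrite ltr_wpDl// mulr_ge0.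
have dp : 0 < Num.min r (eps / (n%:R * C + 1)).
  by rewrite lt_min rp divr_gt0.
exists (Num.min r (eps / (n%:R * C + 1))) => // y.
rewrite lt_min => /andP[/Lip H xy].
rewrite distrC; apply: le_trans H _; rewrite mulrA.
move: xy; rewrite ltr_pdivlMr// => xy; apply: le_trans (ltW xy).
by rewrite mulrC ler_wpM2l// lerDl.
Qed.

Lemma compact_box (M : R) : compact [set x : T | `|x| <= M].
Proof.
apply: bounded_closed_compact.
  exists M; split; first exact: num_real.
  by move=> y /= My x /= xM; apply: le_trans xM (ltW My).
apply: (@preimage_closed _ _ (fun x : T => `|x|) [set r : R | r <= M]).
  by move=> x _; apply: norm_continuous.
exact: closed_le.
Qed.

Lemma heine_box (F : T -> R) (M eps : R) : continuous F -> 0 < eps ->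
  exists2 d, 0 < d & forall x w, `|x| <= M -> `|w| < d -> `|F (x + w) - F x| <= eps.
Proof.
move=> cF eps0.
have cK := @compact_box M.
move/compact_near_coveringP : cK => /(_ T (nbhs (0:T)) (fun w x => `|F (x + w) - F x| <= eps)) cK.
have : nbhs (0:T) (fun w => [set x : T | `|x| <= M] `<=` (fun x => `|F (x + w) - F x| <= eps)).
  apply: cK.
  move=> x _.
  have eps2 : 0 < eps / 2 by rewrite divr_gt0.
  have [d d0 Hd] := (continuous_ballP F x).1 (cF x) _ eps2.
  have d2 : 0 < d / 2 by rewrite divr_gt0.
  exists ([set y : T | `|x - y| < d / 2], [set w : T | `|0 - w| < d / 2]).
    by split; apply/nbhs_normP; exists (d / 2).
  move=> [y w] [/= xy]; rewrite sub0r normrN => wd.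
  have H1 : `|F x - F y| <= eps / 2 by apply: Hd; lra.
  have H2 : `|F x - F (y + w)| <= eps / 2.
    apply: Hd; rewrite opprD addrA; apply: le_lt_trans (ler_normB _ _) _.
    by rewrite [ltRHS](splitr d) ltrD.
  by have := ler_distD (F x) (F (y + w)) (F y); rewrite (distrC _ (F x)); lra.
move=> /nbhs_normP[d d0 Hd]; exists d => // x w xM wd.
by apply: (Hd w) => //=; rewrite sub0r normrN.
Qed.

Lemma bounded_box (F : T -> R) (M : R) : continuous F ->
  exists2 C, 0 <= C & forall x, `|x| <= M -> `|F x| <= C.
Proof.
move=> cF.
have cK := @compact_box M.
have cFK : compact (F @` [set x : T | `|x| <= M]).
  apply: continuous_compact => //; exact: continuous_subspaceT.
have [C [Cr HC]] := compact_bounded cFK.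
exists (`|C| + 1); first by rewrite addr_ge0.
move=> x xM; apply: (HC (`|C| + 1)); last by exists x.
by rewrite ltr_pwDr// real_ler_norm.
Qed.

Definition quotient_at (h : R) a (p : T -> R) (x : T) : R :=
  h^-1 * (p (x + h *: e a) - p x).

(** The displacement w makes room for the difference quotients at neighbouring
    grid points that occur in the discrete integration by parts. *)
Lemma quotient_unif (p : T -> R) (a : 'I_n) (M eps : R) : C1 setT p -> 0 < eps ->
  exists2 d, 0 < d & forall h x w, 0 < h < d -> `|x| <= M -> `|w| <= h ->
    `|quotient_at h a p (x + w) - 'D_(e a) p x| <= eps.
Proof.
move=> Cp eps0.
have [|d d0 Hd] := @heine_box ('D_(e a) p) M eps _ eps0.
  by move=> x; have [] := Cp a x I.
exists (d / 2); first by rewrite divr_gt0.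
move=> h x w /andP[h0 hd] xM wh.
have [|t /andP[t0 t1] E] := @mvt_direction R T p (x + w) (e a) h.
  by move=> t _; have [] := Cp a (x + w + (t * h) *: e a) I.
rewrite /quotient_at E mulrA mulVf ?gt_eqF// mul1r -addrA.
apply: Hd => //; apply: le_lt_trans (ler_normD _ _) _.
rewrite norm_scale_delta normrM (ger0_norm t0) (gtr0_norm h0).
have : t * h <= 1 * h by rewrite ler_wpM2r// ltW.
move: hd; rewrite ltr_pdivlMr//; lra.
Qed.

End C1Functions.

Section PointwiseContinuity.
Variables (R : realType) (U : topologicalType).

Lemma for_continuousM (f g : U -> R) (x : U) : {for x, continuous f} ->
  {for x, continuous g} -> {for x, continuous (fun y => f y * g y)}.
Proof. by move=> cf cg; exact: (@continuousM _ _ f g x cf cg). Qed.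

Lemma for_continuousD (W : normedModType R) (f g : U -> W) (x : U) :
  {for x, continuous f} -> {for x, continuous g} ->
  {for x, continuous (fun y => f y + g y)}.
Proof. by move=> cf cg; exact: (@continuousD _ _ _ f g x cf cg). Qed.

End PointwiseContinuity.

Section C1Algebra.
Variables (R : realType) (n : nat).
Local Notation T := 'rV[R]_n.
Local Notation e a := (delta_mx 0 a : 'rV[R]_n).

Lemma derive_mul (p q : T -> R) (x v : T) : derivable p x v -> derivable q x v ->
  'D_v (fun y => p y * q y) x = p x * 'D_v q x + q x * 'D_v p x.
Proof. by move=> dp dq; exact: (@deriveM R _ p q x v dp dq). Qed.

Lemma C1M (V : set T) (p q : T -> R) : open V -> C1 V p -> C1 V q ->
  C1 V (fun x => p x * q x).
Proof.
move=> oV Cp Cq.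
apply: (@C1I _ _ _ V _ (fun a x => p x * 'D_(e a) q x + q x * 'D_(e a) p x)) => //.
  move=> a x Vx; have [dp _] := Cp a x Vx; have [dq _] := Cq a x Vx.
  by apply: DeriveDef; [exact: (@derivableM R _ p q x _ dp dq)|exact: derive_mul].
move=> a x Vx; have [_ cp] := Cp a x Vx; have [_ cq] := Cq a x Vx.
have cp0 := C1_continuous oV Cp Vx; have cq0 := C1_continuous oV Cq Vx.
apply: (@for_continuousD _ _ _ (fun y => p y * 'D_(e a) q y)).
  exact: for_continuousM cp0 cq.
exact: for_continuousM cq0 cp.
Qed.

Lemma C1_comp (V : set T) (k dk : R -> R) (p : T -> R) : open V ->
  (forall x, V x -> is_derive (p x) 1 k (dk (p x))) ->
  (forall x, V x -> {for p x, continuous dk}) -> C1 V p ->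
  C1 V (fun x => k (p x)).
Proof.
move=> oV Hk cdk Cp.
apply: (@C1I _ _ _ V _ (fun a x => dk (p x) * 'D_(e a) p x)) => //.
  move=> a x Vx; have [dp _] := Cp a x Vx.
  by apply: (@is_derive_comp1 _ _ k p); [exact: Hk|exact: derivableP].
move=> a x Vx; have [_ cp] := Cp a x Vx.
apply: for_continuousM => //; apply: (@continuous_comp _ _ _ p dk); last exact: cdk.
exact: (C1_continuous oV Cp Vx).
Qed.

Lemma derive_comp1 (k : R -> R) (dk : R) (p : T -> R) (x v : T) :
  is_derive (p x) 1 k dk -> derivable p x v ->
  'D_v (fun y => k (p y)) x = dk * 'D_v p x.
Proof.
move=> Hk dp.
have H := derivableP dp.
by have [_] := is_derive_comp1 Hk H.
Qed.

Lemma C1_cst (V : set T) (W : normedModType R) (c : W) : C1 V (fun=> c).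
Proof.
move=> a x _; split; first exact: derivable_cst.
rewrite (_ : 'D_(e a) (fun=> c) = cst 0); first exact: cst_continuous.
by apply/funext => y; rewrite derive_cst.
Qed.

Lemma is_derive_coord (a : 'I_n) (x v : T) :
  is_derive x v (fun y : T => y 0 a) (v 0 a).
Proof.
have df : differentiable (fun y : T => y 0 a) x by exact: differentiable_coord.
apply: DeriveDef; first exact: diff_derivable.
rewrite deriveE//.
have L : linear (fun y : T => y 0 a : R) by move=> c y z; rewrite !mxE.
pose f : {linear T -> R} := HB.pack (fun y : T => y 0 a : R)
  (GRing.isLinear.Build _ _ _ _ _ L).
by rewrite (@diff_lin _ _ _ f)//; exact: coord_continuous.
Qed.

Lemma derive_coord (a b : 'I_n) (x : T) :
  'D_(e b) (fun y : T => y 0 a) x = (a == b)%:R.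
Proof. by have [_ ->] := is_derive_coord a x (e b); rewrite !mxE eqxx. Qed.

Lemma C1_coord (V : set T) (a : 'I_n) : open V -> C1 V (fun x : T => x 0 a : R).
Proof.
move=> oV; apply: (@C1I _ _ R V _ (fun b x => (a == b)%:R : R)) => //.
  by move=> b x _; apply: is_derive_eq (is_derive_coord a x (e b)) _; rewrite !mxE eqxx.
by move=> b x _; exact: cst_continuous.
Qed.

Lemma derive_add (p q : T -> R) (x v : T) : derivable p x v -> derivable q x v ->
  'D_v (fun y => p y + q y) x = 'D_v p x + 'D_v q x.
Proof. by move=> dp dq; exact: (@deriveD R _ _ p q x v dp dq). Qed.

Lemma C1D (V : set T) (p q : T -> R) : open V -> C1 V p -> C1 V q ->
  C1 V (fun x => p x + q x).
Proof.
move=> oV Cp Cq.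
apply: (@C1I _ _ _ V _ (fun a x => 'D_(e a) p x + 'D_(e a) q x)) => //.
  move=> a x Vx; have [dp _] := Cp a x Vx; have [dq _] := Cq a x Vx.
  by apply: DeriveDef; [exact: (@derivableD R _ _ p q x _ dp dq)|exact: derive_add].
move=> a x Vx; have [_ cp] := Cp a x Vx; have [_ cq] := Cq a x Vx.
exact: (@for_continuousD _ _ _ _ _ x cp cq).
Qed.

End C1Algebra.

(** * Riemann sums on a periodic grid *)

Section RiemannSums.
Variables (R : realType) (n : nat) (M : R).
Hypothesis M0 : 0 < M.
Local Notation T := 'rV[R]_n.
Local Notation e a := (delta_mx 0 a : 'rV[R]_n).

(** The grid has N + 2 points in each direction because the index type 'Z_n is
    the ring of integers modulo n only when n is at least 2.  Its points carry
    a cyclic group structure, so that shifting by one step is a bijection. *)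
Definition mesh N : R := 2 * M / N.+2%:R.

Definition node N (k : 'rV['Z_N.+2]_n) : T :=
  \row_a (- M + mesh N * (k 0 a : nat)%:R).

Definition riemann_sum (F : T -> R) N : R :=
  mesh N ^+ n * \sum_(k : 'rV['Z_N.+2]_n) F (node k).

Lemma mesh_gt0 N : 0 < mesh N.
Proof. by rewrite /mesh divr_gt0// mulr_gt0. Qed.

Lemma mesh_cvg : mesh @ \oo --> 0.
Proof.
rewrite -(mulr0 (2 * M)); apply: cvgM; first exact: cvg_cst.
have := @cvg_harmonic R; rewrite -(cvg_shiftS) /harmonic /=.
done.
Qed.

Lemma node_le N (k : 'rV['Z_N.+2]_n) : `|node k| <= M.
Proof.
apply: norm_rV_le; first exact: ltW.
move=> a; rewrite mxE ler_norml lerDl.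
have m0 := mesh_gt0 N; rewrite mulr_ge0 ?(ltW m0)//=.
have : mesh N * (k 0 a : nat)%:R <= mesh N * N.+2%:R.
  by rewrite ler_wpM2l ?(ltW m0)// ler_nat ltnW// ltn_ord.
by rewrite {2}/mesh divfK// mulr_natl mulr2n addrC lerBlDr.
Qed.

Lemma riemann_sumD F G N :
  riemann_sum (fun x => F x + G x) N = riemann_sum F N + riemann_sum G N.
Proof. by rewrite /riemann_sum big_split mulrDr. Qed.

Lemma riemann_sumZ c F N :
  riemann_sum (fun x => c * F x) N = c * riemann_sum F N.
Proof. by rewrite /riemann_sum -mulr_sumr mulrCA. Qed.

Lemma riemann_sum_le F G N : (forall x, `|x| <= M -> F x <= G x) ->
  riemann_sum F N <= riemann_sum G N.
Proof.
move=> FG; rewrite /riemann_sum ler_wpM2l//.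
  by rewrite exprn_ge0// ltW// mesh_gt0.
by apply: ler_sum => k _; apply: FG; exact: node_le.
Qed.

Lemma riemann_sum_cst c N : riemann_sum (fun=> c) N = (2 * M) ^+ n * c.
Proof.
have C : #|{: 'rV['Z_N.+2]_n}| = (N.+2 ^ n)%N by rewrite card_mx card_ord mul1n.
rewrite /riemann_sum sumr_const C -(mulr_natr c) natrX mulrCA mulrC; congr (_ * _).
by rewrite -exprMn /mesh divfK.
Qed.

Definition supported (r : R) (F : T -> R) :=
  forall (x : T) a, r <= `|x 0 a| -> F x = 0.

(** The grid is periodic while the function is not: a shift beyond the last grid
    point in direction a leads to the first one, and F vanishes at both. *)
Lemma sum_shift (F : T -> R) N (a : 'I_n) : supported M F ->
  \sum_(k : 'rV['Z_N.+2]_n) F (node k + mesh N *: e a) =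
  \sum_(k : 'rV['Z_N.+2]_n) F (node k).
Proof.
move=> sF.
rewrite [RHS](reindex_inj (addIr (delta_mx 0 a : 'rV['Z_N.+2]_n))) /=.
apply: eq_bigr => k _.
have m0 := mesh_gt0 N.
have kl : (k 0%R a < N.+2)%N by exact: ltn_ord.
case: (ltnP (k 0%R a).+1 N.+2) => [lt|ge].
  congr F; apply/rowP => b; rewrite !mxE !eqxx !andTb.
  case: (eqVneq b a) => [->|_]; last by rewrite !mulr0n mulr0 !addr0.
  rewrite !mulr1n mulr1.
  have -> : ((k 0 a + 1%R)%R : nat) = (k 0%R a).+1 :> nat.
    by rewrite /= !modn_small ?addn1//; rewrite modn_small ?addn1.
  by rewrite -natr1; ring.
have E : (k 0%R a).+1 = N.+2 by apply/eqP; rewrite eqn_leq ge kl.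
rewrite (sF _ a) ?(sF _ a)//.
  rewrite !mxE !eqxx !andTb mulr1n.
  have -> : nat_of_ord (k 0 a + 1%R)%R = 0%N.
    by rewrite /= modnDmr addn1 E modnn.
  by rewrite mulr0 addr0 normrN gtr0_norm.
rewrite !mxE !eqxx /= mulr1.
have -> : - M + mesh N * (k 0 a)%:R + mesh N = M.
  have -> : - M + mesh N * (k 0 a)%:R + mesh N = - M + mesh N * (k 0%R a).+1%:R.
    by rewrite -natr1; ring.
  by rewrite E /mesh divfK//; ring.
by rewrite gtr0_norm.
Qed.

End RiemannSums.

(** * Null Lagrangians *)

Section NullLagrangian.
Variables (R : realType) (n : nat) (M : R).
Hypothesis M0 : 0 < M.
Local Notation T := 'rV[R]_n.
Local Notation e a := (delta_mx 0 a : 'rV[R]_n).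

(** This stands for the vanishing of the integral of F; the Riemann sums are, like
    the integral, linear and monotone in F. *)
Definition negligible (F : T -> R) := riemann_sum M F @ \oo --> (0 : R).

Lemma riemann_sum_bound (F : T -> R) (c : R) N :
  (forall x, `|x| <= M -> `|F x| <= c) ->
  `|riemann_sum M F N| <= (2 * M) ^+ n * c.
Proof.
move=> Fc; rewrite ler_norml -mulrN -!(riemann_sum_cst n M _ N); apply/andP; split;
  apply: riemann_sum_le => // x /Fc; rewrite ler_norml => /andP[] //.
Qed.

Lemma supported_shift (r h : R) (p : T -> R) (b : 'I_n) : 0 <= h ->
  supported r p -> supported (r + h) (fun x => p (x + h *: e b)).
Proof.
move=> h0 sp x a H; apply: (sp _ a); rewrite !mxE.
have : `|h * (e b) 0 a| <= h.
  rewrite normrM (ger0_norm h0) !mxE eqxx/=.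
  by case: (a == b); rewrite ?normr1 ?mulr1// normr0 mulr0.
have := ler_distD (x 0 a + h * (e b) 0 a) (x 0 a) 0.
rewrite !subr0 opprD addrA subrr add0r normrN !mxE; lra.
Qed.

Lemma supported_le (r s : R) (p : T -> R) : r <= s -> supported r p -> supported s p.
Proof. by move=> rs sp x a H; apply: (sp x a); apply: le_trans H. Qed.

Lemma supportedM (r : R) (p q : T -> R) : supported r p ->
  supported r (fun x => p x * q x).
Proof. by move=> sp x a /sp ->; rewrite mul0r. Qed.

(** With A and B the shifts by one step in the directions a and b,
    (Ap - p)(Bq - q) - (ABp - Ap)(ABq - Bq) is the sum of the three differences
    pq - AB(pq), A(p Bq) - p Bq and B(q Ap) - q Ap, and each of them sums to
    zero over the grid.  No error term appears: this is what allows p and q to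
    be merely C1, although formally two derivatives are commuted. *)
Lemma discrete_null_lagrangian (p q : T -> R) (a b : 'I_n) (r : R) N :
  supported r p -> r + mesh M N <= M ->
  let h := mesh M N in
  riemann_sum M (fun x => quotient_at h a p x * quotient_at h b q x -
    quotient_at h b p (x + h *: e a) * quotient_at h a q (x + h *: e b)) N = 0.
Proof.
move=> sp rM; move: (mesh_gt0 M0 N) rM; set h := mesh M N => h0 rM.
have spM : supported M p by apply: supported_le sp; lra.
pose F1 x := p x * q x.
pose F2 x := p x * q (x + h *: e b).
pose F3 x := p (x + h *: e a) * q x.
pose F4 x := F1 (x + h *: e b).
have s1 : supported M F1 by exact: supportedM.
have s2 : supported M F2 by exact: supportedM.
have s3 : supported M F3.
  by apply: supportedM; apply: supported_le (supported_shift _ (ltW h0) sp).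
have s4 : supported M F4.
  apply: (@supported_le (r + h)) => //; apply: supported_shift; first exact: ltW.
  exact: supportedM.
rewrite /riemann_sum; apply/eqP; rewrite mulf_eq0; apply/orP; right.
pose S F := \sum_(k : 'rV['Z_N.+2]_n) F (node M k) : R.
have E : \sum_(k : 'rV['Z_N.+2]_n) (quotient_at h a p (node M k) * quotient_at h b q (node M k) -
    quotient_at h b p (node M k + h *: e a) * quotient_at h a q (node M k + h *: e b)) =
    h^-1 ^+ 2 * ((S F1 - S (fun x => F4 (x + h *: e a)))
      + (S (fun x => F2 (x + h *: e a)) - S F2)
      + (S (fun x => F3 (x + h *: e b)) - S F3)).
  rewrite /S -!sumrB -!big_split mulr_sumr; apply: eq_bigr => k _ /=.
  rewrite /F1 /F2 /F3 /F4 /F1 /quotient_at.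
  have -> : node M k + h *: e b + h *: e a = node M k + h *: e a + h *: e b by rewrite addrAC.
  ring.
rewrite E /S !sum_shift//.
by rewrite !subrr !addr0 mulr0.
Qed.

(** Formally the integrand is the divergence d_a(p d_b q) - d_b(p d_a q), whose
    integral vanishes; since second derivatives of q may not exist, the identity
    is taken from its discrete counterpart, to which the difference quotients
    converge uniformly. *)
Lemma null_lagrangian (p q : T -> R) (a b : 'I_n) (r : R) :
  r < M -> supported r p -> C1 setT p -> C1 setT q ->
  negligible (fun x => 'D_(e a) p x * 'D_(e b) q x - 'D_(e b) p x * 'D_(e a) q x).
Proof.
move=> rM sp Cp Cq; apply/cvgrPdist_le => eps eps0.
have bd (f : T -> R) c : C1 setT f -> exists2 C : R, 0 <= C & forall x, `|x| <= M -> `|'D_(e c) f x| <= C.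
  by move=> Cf; apply: bounded_box => x; have [] := Cf c x I.
have [C1' C10 H1] := bd p a Cp; have [C2 C20 H2] := bd q b Cq.
have [C3 C30 H3] := bd p b Cp; have [C4 C40 H4] := bd q a Cq.
pose C := C1' + C2 + C3 + C4.
pose K := (2 * M) ^+ n * (2 * (2 * C + 1)).
have C0 : 0 <= C by rewrite /C !addr_ge0.
have [L1 L2 L3 L4] : [/\ C1' <= C, C2 <= C, C3 <= C & C4 <= C].
  by rewrite /C; split; clear - C10 C20 C30 C40; lra.
have K1 : 0 <= 2 * (2 * C + 1) by clear - C0; lra.
have K0 : 0 < K by rewrite /K !mulr_gt0 ?exprn_gt0 ?mulr_gt0//; lra.
pose e1 := Num.min 1 (eps / K).
have e10 : 0 < e1 by rewrite lt_min ltr01 divr_gt0.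
have [d1 d10 Q1] := quotient_unif a M Cp e10.
have [d2 d20 Q2] := quotient_unif b M Cq e10.
have [d3 d30 Q3] := quotient_unif b M Cp e10.
have [d4 d40 Q4] := quotient_unif a M Cq e10.
have mc := mesh_cvg M.
have lt_near (d : R) : 0 < d -> \forall N \near \oo, mesh M N < d.
  move=> d0; move/cvgrPdist_lt : mc => /(_ d d0).
  by apply: filterS => N; rewrite sub0r normrN gtr0_norm// mesh_gt0.
near=> N.
rewrite sub0r normrN.
have hr : mesh M N < M - r by near: N; apply: lt_near; rewrite subr_gt0.
have hd1 : mesh M N < d1 by near: N; exact: lt_near.
have hd2 : mesh M N < d2 by near: N; exact: lt_near.
have hd3 : mesh M N < d3 by near: N; exact: lt_near.
have hd4 : mesh M N < d4 by near: N; exact: lt_near.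
have h0 : 0 < mesh M N by exact: mesh_gt0.
have hM : r + mesh M N <= M by rewrite addrC -lerBrDr ltW.
have Z := discrete_null_lagrangian q a b sp hM.
set h := mesh M N in h0 hr hM hd1 hd2 hd3 hd4 Z.
rewrite -[X in `|X|]subr0 -[X in _ - X]Z -[X in _ - X]mul1r -mulNr -riemann_sumZ -riemann_sumD.
have -> : eps = (2 * M) ^+ n * ((eps / K) * (2 * (2 * C + 1))).
  rewrite mulrCA -/K divfK ?gt_eqF//.
apply: riemann_sum_bound => x xM.
have prod_close (A B A' B' : R) : `|A - A'| <= e1 -> `|B - B'| <= e1 ->
    `|A'| <= C -> `|B'| <= C -> `|A * B - A' * B'| <= e1 * (2 * C + 1).
  move=> HA HB HA' HB'.
  have -> : A * B - A' * B' = (A - A') * (B - B') + (A - A') * B' + A' * (B - B') by ring.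
  apply: le_trans (ler_normD _ _) _; apply: le_trans (lerD (ler_normD _ _) (lexx _)) _.
  rewrite !normrM.
  have G1 : `|A - A'| * `|B - B'| <= e1 * 1.
    by apply: ler_pM => //; apply: le_trans HB _; rewrite ge_min lexx.
  have G2 : `|A - A'| * `|B'| <= e1 * C by exact: ler_pM.
  have G3 : `|A'| * `|B - B'| <= C * e1 by exact: ler_pM.
  by clear - G1 G2 G3; lra.
have P1 := prod_close _ _ _ _ (Q1 h x 0 (introT andP (conj h0 hd1)) xM _) (Q2 h x 0 (introT andP (conj h0 hd2)) xM _).
have nh c : `|h *: e c| <= h by rewrite norm_scale_delta gtr0_norm.
have P2 := prod_close _ _ _ _ (Q3 h x (h *: e a) (introT andP (conj h0 hd3)) xM (nh a)) (Q4 h x (h *: e b) (introT andP (conj h0 hd4)) xM (nh b)).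
rewrite !addr0 !normr0 in P1.
have {}P1 := P1 (ltW h0) (ltW h0).
have B1 : `|'D_(e a) p x| <= C by exact: le_trans (H1 x xM) L1.
have B2 : `|'D_(e b) q x| <= C by exact: le_trans (H2 x xM) L2.
have B3 : `|'D_(e b) p x| <= C by exact: le_trans (H3 x xM) L3.
have B4 : `|'D_(e a) q x| <= C by exact: le_trans (H4 x xM) L4.
have {}P1 := P1 B1 B2; have {}P2 := P2 B3 B4.
set X1 := _ * _ in P1; set Y1 := _ * _ in P1; set X2 := _ * _ in P2; set Y2 := _ * _ in P2.
have -> : Y1 - Y2 + -1 * (X1 - X2) = (X2 - Y2) - (X1 - Y1) by ring.
apply: le_trans (ler_normB _ _) _.
apply: (@le_trans _ _ (e1 * (2 * (2 * C + 1)))); last first.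
  by rewrite ler_wpM2r// ge_min lexx orbT.
rewrite [leRHS](_ : _ = e1 * (2 * C + 1) + e1 * (2 * C + 1)); last by ring.
exact: (lerD P2 P1).
Unshelve. all: by end_near. Qed.

Lemma negligibleD F G : negligible F -> negligible G -> negligible (fun x => F x + G x).
Proof.
move=> nF nG; rewrite /negligible.
have -> : riemann_sum M (fun x => F x + G x) = riemann_sum M F + riemann_sum M G.
  by apply/funext => N; rewrite riemann_sumD.
by rewrite -(addr0 0); exact: cvgD.
Qed.

Lemma negligibleZ c F : negligible F -> negligible (fun x => c * F x).
Proof.
move=> nF; rewrite /negligible.
have -> : riemann_sum M (fun x => c * F x) = (fun N => c * riemann_sum M F N).
  by apply/funext => N; rewrite riemann_sumZ.
by rewrite -(mulr0 c); apply: cvgM => //; exact: cvg_cst.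
Qed.

Lemma negligible_ext F G : F =1 G -> negligible F -> negligible G.
Proof. by move=> /funext ->. Qed.

End NullLagrangian.

Section RadialIdentities.
Variables (R : realType) (n : nat) (M r : R).
Hypotheses (M0 : 0 < M) (rM : r < M).
Local Notation T := 'rV[R]_n.
Local Notation e a := (delta_mx 0 a : 'rV[R]_n).

Lemma derive_coordM (p q : 'I_n) (a : 'I_n) (x : T) :
  'D_(e a) (fun y : T => y 0 p * y 0 q) x =
  x 0 p * (q == a)%:R + x 0 q * (p == a)%:R.
Proof.
by rewrite derive_mul ?derive_coord//; apply: (@ex_derive _ _ _ _ _ _ _ (is_derive_coord _ _ _)).
Qed.

Lemma C1_derivable (V : set T) (W : normedModType R) (p : T -> W) x a :
  C1 V p -> V x -> derivable p x (e a).
Proof. by move=> Cp Vx; have [] := Cp a x Vx. Qed.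
Arguments C1_derivable {V W p} x a _ _.

(** The null Lagrangian with q the coordinate number b is the derivative of F in
    direction a. *)
Lemma negligible_div (F : T -> R) (a b : 'I_n) : a != b ->
  supported r F -> C1 setT F -> negligible M (fun x => 'D_(e a) F x).
Proof.
move=> ab sF CF.
have Cb : C1 setT (fun x : T => x 0 b : R) by apply: C1_coord; exact: openT.
have := @null_lagrangian R n M M0 F _ a b r rM sF CF Cb.
apply: negligible_ext => x; rewrite !derive_coord eqxx eq_sym (negbTE ab).
by rewrite mulr1 mulr0 subr0.
Qed.

(** The Euler field E and the rotation field Rot commute, Rot is divergence free
    and E has divergence 3, so E p Rot q - Rot p E q + 3 p Rot q is formally a
    divergence.  It is a combination of null Lagrangians of q and the products of
    p by the quadratic polynomials xa^2 + xb^2, xc xa and xc xb; the derivatives of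
    these polynomials contribute exactly the term 3 p Rot q. *)
Lemma negligible_rotation (p q : T -> R) (a b c : 'I_n) :
  a != b -> b != c -> a != c ->
  supported r p -> C1 setT p -> C1 setT q ->
  let E (f : T -> R) (x : T) := x 0 a * 'D_(e a) f x + x 0 b * 'D_(e b) f x + x 0 c * 'D_(e c) f x in
  let Rot (f : T -> R) (x : T) := x 0 a * 'D_(e b) f x - x 0 b * 'D_(e a) f x in
  negligible M (fun x => E p x * Rot q x - Rot p x * E q x + 3 * (p x * Rot q x)).
Proof.
move=> ab bc ac sp Cp Cq E Rot.
have oT : open [set: T] by exact: openT.
have Cx i : C1 setT (fun x : T => x 0 i : R) by exact: C1_coord.
have Cxx i j : C1 setT (fun x : T => x 0 i * x 0 j : R).
  exact: (C1M oT (Cx i) (Cx j)).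
have spx i j : supported r (fun x => p x * (x 0 i * x 0 j)) by exact: supportedM.
have Cpx i j : C1 setT (fun x => p x * (x 0 i * x 0 j)).
  exact: (C1M oT Cp (Cxx i j)).
have N1 := @null_lagrangian R n M M0 _ _ a b r rM (spx a a) (Cpx a a) Cq.
have N2 := @null_lagrangian R n M M0 _ _ a b r rM (spx b b) (Cpx b b) Cq.
have N3 := @null_lagrangian R n M M0 _ _ c b r rM (spx c a) (Cpx c a) Cq.
have N4 := @null_lagrangian R n M M0 _ _ c a r rM (spx c b) (Cpx c b) Cq.
have := negligibleD (negligibleD (negligibleD N1 N2) N3) (negligibleZ (-1) N4).
apply: negligible_ext => x; rewrite /E /Rot.
have dp i : derivable p x (e i) by exact: (C1_derivable _ _ Cp I).
have dxx i j k : derivable (fun x : T => x 0 i * x 0 j : R) x (e k).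
  by exact: (C1_derivable _ _ (Cxx i j) I).
rewrite !(@derive_mul _ _ p)// !derive_coordM.
rewrite !eqxx !(eq_sym c) !(eq_sym b a) !(negbTE ab) !(negbTE bc) !(negbTE ac).
move: ('D_(e a) p x) ('D_(e b) p x) ('D_(e c) p x) => pa pb pc.
move: ('D_(e a) q x) ('D_(e b) q x) ('D_(e c) q x) => qa qb qc.
move: (x 0 a) (x 0 b) (x 0 c) (p x) => xa xb xc px.
rewrite !mulr1n !mulr0n.
ring.
Qed.

End RadialIdentities.
Arguments C1_derivable {R n V W p} x a _ _.

(** * Quaternion-valued functions *)

Section QuaternionComponents.
Variables (R : realType) (n : nat).
Local Notation T := 'rV[R]_n.
Local Notation e a := (delta_mx 0 a : 'rV[R]_n).

Lemma derive_entry (v : T -> quat R) (k : 'I_4) (x w : T) : derivable v x w ->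
  'D_w (fun y => v y ord0 k : R) x = 'D_w v x ord0 k.
Proof. by move=> dv; rewrite (derive_mx (M := v) dv) mxE. Qed.

Lemma C1_entry (V : set T) (v : T -> quat R) (k : 'I_4) : open V -> C1 V v ->
  C1 V (fun y => v y ord0 k : R).
Proof.
move=> oV Cv.
apply: (@C1I _ _ R V _ (fun a x => 'D_(e a) v x ord0 k : R)) => //.
  move=> a x Vx; have [dv _] := Cv a x Vx.
  apply: DeriveDef; last exact: derive_entry.
  exact: ((derivable_mxP v x (e a)).1 dv ord0 k).
move=> a x Vx; have [_ cv] := Cv a x Vx.
apply: (@continuous_comp _ _ _ ('D_(e a) v) (fun q : quat R => q ord0 k)) => //.
exact: coord_continuous.
Qed.

Lemma derive_comps (v : T -> quat R) (x w : T) : derivable v x w ->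
  [/\ re ('D_w v x) = 'D_w (fun y => re (v y)) x,
      im_i ('D_w v x) = 'D_w (fun y => im_i (v y)) x,
      im_j ('D_w v x) = 'D_w (fun y => im_j (v y)) x &
      im_k ('D_w v x) = 'D_w (fun y => im_k (v y)) x].
Proof. by move=> dv; split; apply/esym; exact: derive_entry. Qed.

Lemma C1_comps (V : set T) (v : T -> quat R) : open V -> C1 V v ->
  [/\ C1 V (fun y => re (v y) : R), C1 V (fun y => im_i (v y) : R),
      C1 V (fun y => im_j (v y) : R) & C1 V (fun y => im_k (v y) : R)].
Proof. by move=> oV Cv; split; exact: C1_entry. Qed.

End QuaternionComponents.

Definition dotq (R : realType) (p q : quat R) : R :=
  re p * re q + im_i p * im_i q + im_j p * im_j q + im_k p * im_k q.

Section Opposite.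
Variable R : realType.
Implicit Types x : quat R.
Lemma reN x : re (- x) = - re x. Proof. exact: mxE. Qed.
Lemma im_iN x : im_i (- x) = - im_i x. Proof. exact: mxE. Qed.
Lemma im_jN x : im_j (- x) = - im_j x. Proof. exact: mxE. Qed.
Lemma im_kN x : im_k (- x) = - im_k x. Proof. exact: mxE. Qed.
Lemma mulqE (x y : quat R) : x * y = Defs.mulq x y. Proof. by []. Qed.
Lemma oneqE : (1 : quat R) = mkquat 1 0 0 0. Proof. by []. Qed.
End Opposite.
Definition quatNE := (reN, im_iN, im_jN, im_kN).

Section RotationQuaternion.
Variables (R : realType) (n : nat) (M r : R).
Hypotheses (M0 : 0 < M) (rM : r < M).
Local Notation T := 'rV[R]_n.
Local Notation e a := (delta_mx 0 a : 'rV[R]_n).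

(** Left multiplication by an imaginary quaternion m is antisymmetric, and so is
    Rot; thus m Rot is symmetric and commutes with E, while E + 3/2 is
    antisymmetric.  Componentwise, the pairing of p with m q is a combination of
    the differences p_k q_l - p_l q_k, and the scalar lemma applies to each. *)
Lemma negligible_rotation_quat (m : quat R) (v : T -> quat R) (a b c : 'I_n) :
  a != b -> b != c -> a != c -> re m = 0 ->
  (forall (x : T) i, r <= `|x 0 i| -> v x = 0) -> C1 setT v ->
  let E (x : T) := x 0 a *: 'D_(e a) v x + x 0 b *: 'D_(e b) v x + x 0 c *: 'D_(e c) v x in
  let Rot (x : T) := x 0 a *: 'D_(e b) v x - x 0 b *: 'D_(e a) v x in
  negligible M (fun x => 2 * dotq (E x) (m * Rot x) + 3 * dotq (v x) (m * Rot x)).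
Proof.
move=> ab bc ac m0 sv Cv E Rot.
have [C0 C1' C2 C3] := C1_comps openT Cv.
have s0 : supported r (fun y => re (v y)) by move=> x i /sv ->; rewrite re0.
have s1 : supported r (fun y => im_i (v y)) by move=> x i /sv ->; rewrite im_i0.
have s2 : supported r (fun y => im_j (v y)) by move=> x i /sv ->; rewrite im_j0.
have s3 : supported r (fun y => im_k (v y)) by move=> x i /sv ->; rewrite im_k0.
have B (p q : T -> R) (sp : supported r p) (Cp : C1 setT p)
    (sq : supported r q) (Cq : C1 setT q) :=
  negligibleD (@negligible_rotation R n M r M0 rM p q a b c ab bc ac sp Cp Cq)
   (negligibleZ (-1) (@negligible_rotation R n M r M0 rM q p a b c ab bc ac sq Cq Cp)).
have N01 := negligibleZ (- im_i m) (B _ _ s0 C0 s1 C1').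
have N02 := negligibleZ (- im_j m) (B _ _ s0 C0 s2 C2).
have N03 := negligibleZ (- im_k m) (B _ _ s0 C0 s3 C3).
have N13 := negligibleZ (im_j m) (B _ _ s1 C1' s3 C3).
have N12 := negligibleZ (- im_k m) (B _ _ s1 C1' s2 C2).
have N23 := negligibleZ (- im_i m) (B _ _ s2 C2 s3 C3).
have := negligibleD (negligibleD (negligibleD N01 N02) (negligibleD N03 N13)) (negligibleD N12 N23).
apply: negligible_ext => x; rewrite /E /Rot {E Rot B N01 N02 N03 N13 N12 N23}.
have dv i : derivable v x (e i) by have [] := Cv i x I.
have [a0 a1 a2 a3] := derive_comps (dv a).
have [b0 b1 b2 b3] := derive_comps (dv b).
have [c0 c1 c2 c3] := derive_comps (dv c).
rewrite -a0 -a1 -a2 -a3 -b0 -b1 -b2 -b3 -c0 -c1 -c2 -c3.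
move: {a0 a1 a2 a3 b0 b1 b2 b3 c0 c1 c2 c3 C0 C1' C2 C3 s0 s1 s2 s3 sv dv Cv}
  ('D_(e a) v x) ('D_(e b) v x) ('D_(e c) v x) (v x) (x 0 a) (x 0 b) (x 0 c)
  => va vb vc vx xa xb xc.
rewrite /dotq mulqE !(quatE, quatNE) m0.
ring.
Qed.

End RotationQuaternion.

(** * The Carleman identity *)

Lemma add_split_scale (R : pzRingType) (V : lmodType R) (p q v : V) (k l : R) :
  p + q - k *: v = (p + l *: v) + (q + (- (l + k)) *: v).
Proof. by rewrite addrACA -scalerDl opprD addNKr scaleNr. Qed.

Section QuaternionForm.
Variable R : realType.
Implicit Types p q v : quat R.

Lemma dotqDl p q v : dotq (p + q) v = dotq p v + dotq q v.
Proof. by rewrite /dotq !quatE; ring. Qed.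
Lemma dotqDr p q v : dotq v (p + q) = dotq v p + dotq v q.
Proof. by rewrite /dotq !quatE; ring. Qed.
Lemma dotqZl (a : R) p q : dotq (a *: p) q = a * dotq p q.
Proof. by rewrite /dotq !quatE; ring. Qed.
Lemma dotqZr (a : R) p q : dotq p (a *: q) = a * dotq p q.
Proof. by rewrite /dotq !quatE; ring. Qed.
Lemma dotqC p q : dotq p q = dotq q p.
Proof. by rewrite /dotq; ring. Qed.
Lemma dotq_ge0 p : 0 <= dotq p p.
Proof. by rewrite /dotq !addr_ge0// -expr2 sqr_ge0. Qed.
Lemma dotq_gt0 p : p != 0 -> 0 < dotq p p.
Proof.
move=> p0; rewrite lt_neqAle dotq_ge0 andbT eq_sym.
apply: contra_neq p0 => H; apply: sqnormq_eq0.
by rewrite -H /sqnormq /dotq; ring.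
Qed.
Lemma dotq0l p : dotq 0 p = 0.
Proof. by rewrite /dotq !quatE; ring. Qed.

Lemma dotq_sum_ge p q : 2 * dotq p q <= dotq (p + q) (p + q).
Proof.
have := dotq_ge0 p; have := dotq_ge0 q.
by rewrite !dotqDl !dotqDr (dotqC q p); lra.
Qed.

(** As i and I = b j + c k are anticommuting square roots of -1, the conjugate of
    x times the Dirac operator d0 + i d1 + I d2 splits into the Euler field and
    the three rotation fields, the latter multiplied by the imaginary
    quaternions i, I and -iI = c j - b k. *)
Lemma euler_rotation_split (x0 x1 x2 b c : R) (d0 d1 d2 : quat R) :
  b ^+ 2 + c ^+ 2 = 1 ->
  mkquat x0 (- x1) (- (x2 * b)) (- (x2 * c)) *
    (d0 + qi * d1 + mkquat 0 0 b c * d2) =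
  (x0 *: d0 + x1 *: d1 + x2 *: d2) +
  (qi * (x0 *: d1 - x1 *: d0) + mkquat 0 0 b c * (x0 *: d2 - x2 *: d0) +
   mkquat 0 0 c (- b) * (x1 *: d2 - x2 *: d1)).
Proof.
move=> bc; have bc0 : b ^+ 2 + c ^+ 2 - 1 = 0 by rewrite bc subrr.
suff H : forall y z : quat R, y - z = (x2 * (b ^+ 2 + c ^+ 2 - 1)) *: d2 -> y = z.
  apply: H; apply: quatP; rewrite /qi !mulqE !(quatE, quatNE); ring.
by move=> y z; rewrite bc0 mulr0 scale0r => /eqP; rewrite subr_eq0 => /eqP.
Qed.

Lemma slice_paravector_norm (x0 x1 x2 b c : R) (u : quat R) : b ^+ 2 + c ^+ 2 = 1 ->
  mkquat x0 (- x1) (- (x2 * b)) (- (x2 * c)) * (mkquat x0 x1 (x2 * b) (x2 * c) * u) =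
  (x0 * x0 + x1 * x1 + x2 * x2) *: u.
Proof.
move=> bc; have bc0 : b ^+ 2 + c ^+ 2 - 1 = 0 by rewrite bc subrr.
suff H : forall y z : quat R, y - z = (x2 * x2 * (b ^+ 2 + c ^+ 2 - 1)) *: u -> y = z.
  apply: H; apply: quatP; rewrite !mulqE !(quatE, quatNE); ring.
by move=> y z; rewrite bc0 mulr0 scale0r => /eqP; rewrite subr_eq0 => /eqP.
Qed.

(** The cross term 2 (E v + 3/2 v, Gamma v - (3/2 + k) v) of the square of a sum,
    written as the three rotation expressions minus the divergence of
    (3/2 + k) (v, v) x, up to the term coming from the derivative dk of k along
    the Euler field.  The symbols A stand for the three parts of Gamma v. *)
Lemma carleman_algebra (d0 d1 d2 v A01 A02 A12 : quat R) (x0 x1 x2 k dk : R) :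
  2 * dotq (x0 *: d0 + x1 *: d1 + x2 *: d2) A01 + 3 * dotq v A01 +
  (2 * dotq (x0 *: d0 + x2 *: d2 + x1 *: d1) A02 + 3 * dotq v A02) +
  (2 * dotq (x1 *: d1 + x2 *: d2 + x0 *: d0) A12 + 3 * dotq v A12) +
  -1 * ((3 / 2 + k) * dotq v v + 2 * x0 * x0 * dk * dotq v v +
          2 * x0 * (3 / 2 + k) * dotq d0 v +
        ((3 / 2 + k) * dotq v v + 2 * x1 * x1 * dk * dotq v v +
          2 * x1 * (3 / 2 + k) * dotq d1 v) +
        ((3 / 2 + k) * dotq v v + 2 * x2 * x2 * dk * dotq v v +
          2 * x2 * (3 / 2 + k) * dotq d2 v)) +
  2 * (x0 * x0 + x1 * x1 + x2 * x2) * dk * dotq v v =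
  2 * dotq (x0 *: d0 + x1 *: d1 + x2 *: d2 + (3 / 2) *: v)
    (A01 + A02 + A12 + (- (3 / 2 + k)) *: v).
Proof. by rewrite !(dotqDl, dotqDr, dotqZl, dotqZr); field. Qed.

End QuaternionForm.

Section Carleman.
Variables (R : realType) (M r b c : R).
Hypotheses (M0 : 0 < M) (rM : r < M) (bc1 : b ^+ 2 + c ^+ 2 = 1).
Local Notation T := 'rV[R]_3.
Local Notation e a := (delta_mx 0 a : 'rV[R]_3).

Definition sqr_dist (x : T) : R := x 0 0 * x 0 0 + x 0 1 * x 0 1 + x 0 2 * x 0 2.

Lemma sqr_dist_ge0 (x : T) : 0 <= sqr_dist x.
Proof. by rewrite /sqr_dist !addr_ge0// -expr2 sqr_ge0. Qed.

Lemma C1_sqr_dist (V : set T) : open V -> C1 V sqr_dist.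
Proof.
move=> oV.
have Cx i : C1 V (fun x : T => x 0 i : R) by exact: (C1_coord i oV).
have Cxx i := C1M oV (Cx i) (Cx i).
exact: (C1D oV (C1D oV (Cxx 0) (Cxx 1)) (Cxx 2)).
Qed.

Lemma ord3P (P : 'I_3 -> Prop) : P 0 -> P 1 -> P 2 -> forall a, P a.
Proof.
move=> P0 P1 P2 [[|[|[|//]]] i].
- by rewrite (_ : Ordinal i = 0)//; exact: val_inj.
- by rewrite (_ : Ordinal i = 1)//; exact: val_inj.
- by rewrite (_ : Ordinal i = 2)//; exact: val_inj.
Qed.

Lemma derive_sqr_dist (x : T) a : 'D_(e a) sqr_dist x = 2 * x 0 a.
Proof.
have Cx i : C1 setT (fun x : T => x 0 i : R) by exact: (C1_coord i openT).
have Cxx i := C1M openT (Cx i) (Cx i).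
have dxx i j := C1_derivable x j (Cxx i) I.
have dxxD := C1_derivable x a (C1D openT (Cxx 0) (Cxx 1)) I.
rewrite (derive_add dxxD (dxx 2 a)) (derive_add (dxx 0 a) (dxx 1 a)) !derive_coordM.
by move: a {dxxD}; apply: ord3P; rewrite /= ?mulr1n ?mulr0n; ring.
Qed.

Lemma C1_dotq (V : set T) (v : T -> quat R) : open V -> C1 V v ->
  C1 V (fun x => dotq (v x) (v x)).
Proof.
move=> oV Cv; have [C0 C1' C2 C3] := C1_comps oV Cv.
exact: (C1D oV (C1D oV (C1D oV (C1M oV C0 C0) (C1M oV C1' C1')) (C1M oV C2 C2)) (C1M oV C3 C3)).
Qed.

Lemma derive_dotq (v : T -> quat R) (x : T) a : C1 setT v ->
  'D_(e a) (fun y => dotq (v y) (v y)) x = 2 * dotq ('D_(e a) v x) (v x).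
Proof.
move=> Cv; have [C0 C1' C2 C3] := C1_comps openT Cv.
have dv : derivable v x (e a) by have [] := Cv a x I.
have [a0 a1 a2 a3] := derive_comps dv.
have d0 := C1_derivable x a C0 I; have d1 := C1_derivable x a C1' I.
have d2 := C1_derivable x a C2 I; have d3 := C1_derivable x a C3 I.
have m0 := C1M openT C0 C0; have m1 := C1M openT C1' C1'.
have m2 := C1M openT C2 C2; have m3 := C1M openT C3 C3.
have dm0 := C1_derivable x a m0 I; have dm1 := C1_derivable x a m1 I.
have dm2 := C1_derivable x a m2 I; have dm3 := C1_derivable x a m3 I.
have dm01 := C1_derivable x a (C1D openT m0 m1) I.
have dm012 := C1_derivable x a (C1D openT (C1D openT m0 m1) m2) I.
rewrite /dotq a0 a1 a2 a3.
rewrite (derive_add dm012 dm3) (derive_add dm01 dm2) (derive_add dm0 dm1).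
rewrite (derive_mul d0 d0) (derive_mul d1 d1) (derive_mul d2 d2) (derive_mul d3 d3).
ring.
Qed.

Definition dirac (v : T -> quat R) (x : T) : quat R :=
  'D_(e 0) v x + qi * 'D_(e 1) v x + mkquat 0 0 b c * 'D_(e 2) v x.

Definition paravector_conj (x : T) : quat R :=
  mkquat (x 0 0) (- x 0 1) (- (x 0 2 * b)) (- (x 0 2 * c)).

(** With E the Euler field and Gamma the rotation part, W is the sum of
    E v + 3/2 v and Gamma v - (3/2 + k) v, so the square of W is at least twice
    their product.  E + 3/2 is antisymmetric and Gamma - 3/2 symmetric, and they
    commute; hence after summation only the commutator of E with the radial
    function k survives, which is 2 s k'(s) at squared distance s.  Everything
    else is collected in G. *)
Lemma carleman_identity (v : T -> quat R) (k dk : R -> R) :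
  (forall (x : T) i, r <= `|x 0 i| -> v x = 0) -> C1 setT v ->
  (forall t : R, 0 <= t -> is_derive t 1 k (dk t)) ->
  (forall t : R, 0 <= t -> {for t, continuous dk}) ->
  exists2 G : T -> R, negligible M G &
    forall x W, W = paravector_conj x * dirac v x - k (sqr_dist x) *: v x ->
      G x + 2 * sqr_dist x * dk (sqr_dist x) * dotq (v x) (v x) <= dotq W W.
Proof.
move=> sv Cv Hk cdk.
have oT : open [set: T] by exact: openT.
pose F (a : 'I_3) (x : T) := x 0 a * (3 / 2 + k (sqr_dist x)) * dotq (v x) (v x).
have Cx i : C1 setT (fun x : T => x 0 i : R) by exact: (C1_coord i oT).
have Hkx (x : T) : is_derive (sqr_dist x) 1 k (dk (sqr_dist x)).
  exact: Hk (sqr_dist_ge0 x).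
have Ck : C1 setT (fun x => k (sqr_dist x)).
  apply: (C1_comp oT (fun x _ => Hkx x) _ (C1_sqr_dist oT)).
  by move=> x _; exact: cdk (sqr_dist_ge0 x).
have Ckc : C1 setT (fun x => 3 / 2 + k (sqr_dist x)) := C1D oT (@C1_cst _ _ setT R (3 / 2)) Ck.
have Cd : C1 setT (fun x => dotq (v x) (v x)) := C1_dotq oT Cv.
have Cxk a := C1M oT (Cx a) Ckc.
have CF a : C1 setT (F a) := C1M oT (Cxk a) Cd.
have sF a : supported r (F a) by move=> x i /sv H; rewrite /F H dotq0l mulr0.
have DF a x : 'D_(e a) (F a) x = (3 / 2 + k (sqr_dist x)) * dotq (v x) (v x) +
   2 * x 0 a * x 0 a * dk (sqr_dist x) * dotq (v x) (v x) +
   2 * x 0 a * (3 / 2 + k (sqr_dist x)) * dotq ('D_(e a) v x) (v x).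
  have Dx b := C1_derivable x b (Cx a) I.
  have Dk b := C1_derivable x b Ck I.
  have Dkc b := C1_derivable x b Ckc I.
  have Dd b := C1_derivable x b Cd I.
  have Ds b := C1_derivable x b (C1_sqr_dist oT) I.
  have Dc b := C1_derivable x b (@C1_cst _ _ setT R (3 / 2)) I.
  rewrite /F (derive_mul (C1_derivable x a (Cxk a) I) (Dd a)).
  rewrite (derive_mul (Dx a) (Dkc a)) (derive_add (Dc a) (Dk a)) derive_coord eqxx.
  rewrite (derive_comp1 (Hkx x) (Ds a)) derive_sqr_dist (derive_dotq _ _ Cv).
  rewrite derive_cst.
  rewrite mulr1n.
  ring.
have N01 := @negligible_rotation_quat R 3 M r M0 rM qi v 0 1 2 isT isT isT (reE 0 1 0 0) sv Cv.
have N02 := @negligible_rotation_quat R 3 M r M0 rM (mkquat 0 0 b c) v 0 2 1 isT isT isT (reE 0 0 b c) sv Cv.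
have N12 := @negligible_rotation_quat R 3 M r M0 rM (mkquat 0 0 c (- b)) v 1 2 0 isT isT isT (reE 0 0 c (- b)) sv Cv.
have V0 := @negligible_div R 3 M r M0 rM (F 0) 0 1 isT (sF 0) (CF 0).
have V1 := @negligible_div R 3 M r M0 rM (F 1) 1 0 isT (sF 1) (CF 1).
have V2 := @negligible_div R 3 M r M0 rM (F 2) 2 0 isT (sF 2) (CF 2).
have := negligibleD (negligibleD (negligibleD N01 N02) N12) (negligibleZ (-1) (negligibleD (negligibleD V0 V1) V2)).
set G := (X in negligible _ X) => NG; exists G => // x W WE.
have -> : W = (x 0 0 *: 'D_(e 0) v x + x 0 1 *: 'D_(e 1) v x + x 0 2 *: 'D_(e 2) v x + (3 / 2) *: v x) +
  ((qi * (x 0 0 *: 'D_(e 1) v x - x 0 1 *: 'D_(e 0) v x) +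
   mkquat 0 0 b c * (x 0 0 *: 'D_(e 2) v x - x 0 2 *: 'D_(e 0) v x) +
   mkquat 0 0 c (- b) * (x 0 1 *: 'D_(e 2) v x - x 0 2 *: 'D_(e 1) v x)) +
   (- (3 / 2 + k (sqr_dist x))) *: v x).
  rewrite WE [paravector_conj x * dirac v x](euler_rotation_split _ _ _ _ _ _ bc1).
  exact: add_split_scale.
apply: le_trans (dotq_sum_ge _ _).
clear NG; rewrite {W WE}/G {G} !DF.
rewrite le_eqVlt; apply/orP; left; apply/eqP.
exact: carleman_algebra.
Qed.

End Carleman.

(** * A lower bound for Riemann sums *)

Section RiemannLowerBound.
Variables (R : realType) (n : nat) (M : R).
Hypothesis M0 : 0 < M.
Local Notation T := 'rV[R]_n.

(** A cube of about rho / mesh grid points in each direction fits into the ball;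
    half of the side is given away to absorb the rounding. *)
Lemma riemann_sum_ball (y : T) (rho : R) : 0 < rho ->
  (forall a, `|y 0 a| + rho < M) ->
  \forall N \near \oo,
    (rho / 2) ^+ n <= riemann_sum M (fun x => if `|x - y| <= rho then 1 else 0) N.
Proof.
move=> rho0 yM.
have rho2 : 0 < rho / 2 by rewrite divr_gt0.
have mesh_small : \forall N \near \oo, mesh M N < rho / 2.
  have /cvgrPdist_lt /(_ _ rho2) := mesh_cvg M.
  by apply: filterS => N; rewrite sub0r normrN gtr0_norm// mesh_gt0.
near=> N.
have hr : mesh M N < rho / 2 by near: N.
have h0 := mesh_gt0 M0 N; set h := mesh M N in hr h0 *.
pose L := Num.truncn (rho / h).
have /andP[L1 L2] : L%:R <= rho / h < L.+1%:R.
  by apply: Num.Theory.truncn_itv; rewrite divr_ge0// ltW.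
have {}L1 : h * L%:R <= rho by rewrite mulrC -ler_pdivlMr.
have {}L2 : rho / 2 <= h * L%:R.
  move: L2; rewrite ltr_pdivrMr// -natr1 mulrDl mul1r mulrC; lra.
pose k0 (a : 'I_n) := Num.truncn ((y 0 a - rho + M) / h).
have k0P a : h * (k0 a)%:R <= y 0 a - rho + M < h * (k0 a)%:R + h.
  have H : 0 <= (y 0 a - rho + M) / h.
    rewrite divr_ge0 ?(ltW h0)//; have := yM a; have := ler_norm (- y 0 a).
    by rewrite normrN; lra.
  have := Num.Theory.truncn_itv H; rewrite -/(k0 a) ler_pdivlMr// ltr_pdivrMr//.
  by rewrite -natr1 mulrDl mul1r mulrC.
have node_in a (t : 'I_L) : - rho <= - M + h * (k0 a + t).+1%:R - y 0 a <= rho.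
  have /andP[k1 k2] := k0P a.
  have Ht : h * (t : nat).+1%:R <= h * L%:R.
    by rewrite ler_wpM2l ?(ltW h0)// ler_nat ltn_ord.
  have Ht1 : h <= h * (t : nat).+1%:R.
    by rewrite ler_peMr ?(ltW h0)// ler1n.
  have -> : h * (k0 a + t).+1%:R = h * (k0 a)%:R + h * (t : nat).+1%:R.
    by rewrite -addnS natrD mulrDr.
  by apply/andP; split; lra.
have idx a (t : 'I_L) : ((k0 a + t).+1 < N.+2)%N.
  have /andP[_ H] := node_in a t.
  rewrite -(ltr_nat R) -(ltr_pM2l h0).
  have -> : h * N.+2%:R = 2 * M by rewrite /h /mesh divfK.
  have := yM a; have := ler_norm (y 0 a); lra.
(* g embeds a cube of L^n indices into the grid, with all its nodes in the ball. *)
pose g (t : 'rV['I_L]_n) : 'rV['Z_N.+2]_n := \row_a (Ordinal (idx a (t 0 a))).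
have g_inj : injective g.
  move=> t t' /rowP E; apply/rowP => a; apply: val_inj.
  by have := E a; rewrite !mxE => /(congr1 val)/= [] /addnI.
have inball t : `|node M (g t) - y| <= rho.
  apply: norm_rV_le; first exact: ltW.
  by move=> a; rewrite !mxE ler_norml; exact: node_in.
have cardg : #|[set g t | t in [set: 'rV['I_L]_n]]%SET| = (L ^ n)%N.
  by rewrite card_imset// cardsT card_mx card_ord mul1n.
apply: (@le_trans _ _ (h ^+ n * (L ^ n)%:R)).
  rewrite natrX -exprMn lerXn2r// nnegrE ?(ltW rho2)//.
  by rewrite mulr_ge0// ltW.
rewrite /riemann_sum ler_wpM2l ?exprn_ge0 ?(ltW h0)//.
rewrite (bigID (fun k => k \in [set g t | t in [set: 'rV['I_L]_n]]%SET)) /=.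
rewrite ler_wpDr//; first by apply: sumr_ge0 => k _; case: ifP.
rewrite (eq_bigr (fun=> 1)).
  by rewrite sumr_const cardg.
by move=> k /imsetP[t _ ->]; rewrite inball.
Unshelve. all: by end_near. Qed.

End RiemannLowerBound.

(** * Products, gluing and weights *)

Section ScaledFunctions.
Variables (R : realType).

Lemma is_derive_scale (U W : normedModType R) (m : U -> R) (u : U -> W) (x v : U) :
  derivable m x v -> derivable u x v ->
  is_derive x v (fun y => m y *: u y) (m x *: 'D_v u x + 'D_v m x *: u x).
Proof.
move=> dm du.
have cm : {for 0, continuous (fun h : R => m (h *: v + x))}.
  exact/differentiable_continuous/derivable1_diffP/(derivable1P _ _ _).1.
have cm' : (fun h : R => m (h *: v + x)) @ 0^' --> m x.
  by have := (continuous_withinNx _ _).1 cm; rewrite /= scale0r add0r.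
have H : (fun h : R => h^-1 *: (m (h *: v + x) *: u (h *: v + x) - m x *: u x))
    @ 0^' --> m x *: 'D_v u x + 'D_v m x *: u x.
  rewrite (_ : (fun h : R => _) = (fun h : R => m (h *: v + x) *: (h^-1 *: (u (h *: v + x) - u x)) +
      (h^-1 *: (m (h *: v + x) - m x)) *: u x)); last first.
    apply/funext => h /=.
    rewrite scalerA mulrC -scalerA -scalerA -scalerDr; congr (_ *: _).
    by rewrite scalerBr scalerBl addrA subrK.
  apply: cvgD; first by apply: cvgZ => //; exact: du.
  by apply: cvgZ; [exact: dm|exact: cvg_cst].
apply: DeriveDef; first by apply/cvg_ex; exists (m x *: 'D_v u x + 'D_v m x *: u x).
exact: cvg_lim H.
Qed.

(** At t = 0 the two one-sided quotients tend to d and to 0; the hypothesis that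
    d vanishes for nonpositive t makes them agree. *)
Lemma is_derive_max0 (W : normedModType R) (k : R -> W) (t : R) (d : W) :
  is_derive (Num.max 0 t) 1 k d -> (t <= 0 -> d = 0) ->
  is_derive t 1 (fun s => k (Num.max 0 s)) d.
Proof.
move=> Hk d0; case: (ltgtP t 0) => [t0|t0|t0].
- rewrite (d0 (ltW t0)).
  apply: (@near_eq_is_derive _ _ _ (cst (k 0))).
  have : \near t, t < 0 by exact: lt_nbhsl.
  by apply: filterS => s s0; rewrite max_l// ltW.
- rewrite max_r ?(ltW t0)// in Hk.
  apply: (@near_eq_is_derive _ _ _ k) => //.
  have : \near t, 0 < t by exact: lt_nbhsr.
  by apply: filterS => s s0; rewrite max_r// ltW.
rewrite t0 maxxx in Hk *; rewrite {}d0 ?t0// in Hk *.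
have [dk k0] := Hk.
suff H : (fun h : R => h^-1 *: (((fun s => k (Num.max 0 s)) \o shift 0) (h *: (1:R)) - k (Num.max 0 0))) @ 0^' --> (0 : W).
  by apply: DeriveDef; [apply/cvg_ex; exists 0|exact: cvg_lim H].
have H : (fun h : R => h^-1 *: ((k \o shift 0) (h *: (1:R)) - k 0)) @ 0^' --> (0 : W).
  by rewrite -k0; exact: dk.
apply/cvgrPdist_le => eps eps0.
move/cvgrPdist_le : H => /(_ eps eps0); apply: filterS => h /=.
rewrite !addr0 [h *: 1]mulr1 maxxx.
case: (leP 0 h) => [h0|h0]; first by [].
move=> _; by rewrite subrr scaler0 subrr normr0 ltW.
Qed.

End ScaledFunctions.

Section C1Gluing.
Variables (R : realType) (n : nat).
Local Notation T := 'rV[R]_n.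
Local Notation e a := (delta_mx 0 a : 'rV[R]_n).

Lemma C1_eq (W : normedModType R) (V : set T) (f g : T -> W) : open V ->
  (forall x, V x -> f x = g x) -> C1 V g -> C1 V f.
Proof.
move=> oV fg Cg.
have fgn x : V x -> \near x, f x = g x.
  move=> Vx; have : nbhs x V by exact: open_nbhs_nbhs.
  exact: filterS.
apply: (C1I (dp := fun a => 'D_(e a) g)) => // a x Vx.
  have [dg _] := Cg a x Vx.
  apply: (@near_eq_is_derive _ _ _ g).
    by apply: filterS (fgn x Vx) => y ->.
  exact: derivableP.
by have [] := Cg a x Vx.
Qed.

Lemma C1_cover (W : normedModType R) (U V : set T) (f : T -> W) :
  (forall x, U x \/ V x) -> C1 U f -> C1 V f -> C1 setT f.
Proof. by move=> UV CU CV a x _; case: (UV x) => [/(CU a)|/(CV a)]. Qed.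

Lemma C1Z (W : normedModType R) (V : set T) (m : T -> R) (u : T -> W) : open V ->
  (forall x, V x -> {for x, continuous u}) ->
  C1 V m -> C1 V u -> C1 V (fun x => m x *: u x).
Proof.
move=> oV cu Cm Cu.
apply: (C1I (dp := fun a x => m x *: 'D_(e a) u x + 'D_(e a) m x *: u x)) => //.
  move=> a x Vx; have [dm _] := Cm a x Vx; have [du _] := Cu a x Vx.
  exact: is_derive_scale.
move=> a x Vx; have [_ cdm] := Cm a x Vx; have [_ cdu] := Cu a x Vx.
have cux := cu x Vx; have cmx := C1_continuous oV Cm Vx.
apply: for_continuousD.
  exact: (@continuousZ _ _ _ m ('D_(e a) u) x cmx cdu).
exact: (@continuousZ _ _ _ ('D_(e a) m) u x cdm cux).
Qed.

End C1Gluing.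

Lemma continuous_rV (R : realType) (U : topologicalType) (n : nat)
    (f : U -> 'rV[R]_n) (x : U) :
  (forall i, {for x, continuous (fun y => f y 0 i : R)}) -> {for x, continuous f}.
Proof.
move=> cf; apply/cvgrPdist_le => eps eps0.
have H : \forall y \near x, forall i, `|f x 0 i - f y 0 i| <= eps.
  apply: (@filter_forall U 'I_n (fun i y => `|f x 0 i - f y 0 i| <= eps) (nbhs x)) => i.
  have := cf i; rewrite /prop_for /continuous_at => /cvgrPdist_le /(_ eps eps0).
  exact.
apply: filterS H => y H; apply: norm_rV_le; first exact: ltW.
by move=> i; rewrite !mxE.
Qed.

Lemma C1_quat_continuous (R : realType) (n : nat) (V : set 'rV[R]_n)
    (u : 'rV[R]_n -> quat R) : open V -> C1 V u ->
  forall x, V x -> {for x, continuous u}.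
Proof.
move=> oV Cu x Vx; apply: (@continuous_rV _ _ _ (u : _ -> 'rV[R]_4)) => k.
exact: (C1_continuous oV (C1_entry k oV Cu) Vx).
Qed.

Section Weights.
Variable R : realType.

(** The square makes the positive part C1, which is all that is asked from a
    cutoff function here. *)
Definition pos_sqr (t : R) : R := Num.max 0 t ^+ 2.

Lemma is_derive_pos_sqr (t : R) : is_derive t 1 pos_sqr (2 * Num.max 0 t).
Proof.
apply: (@is_derive_max0 R R (fun s => s ^+ 2) t).
  by apply: is_derive_eq; rewrite /GRing.scale /=; ring.
by move=> t0; rewrite max_l// mulr0.
Qed.

Lemma continuous_max0 : continuous (fun t : R => Num.max 0 t).
Proof. by move=> t; apply: continuous_max; [exact: cvg_cst|exact: cvg_id]. Qed.

Variables (tau eta : R).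
Hypothesis eta0 : 0 < eta.

(** With t the squared distance to the centre of a ball, 1 / (t + eta) is a
    decreasing weight without singularity at the centre.  It is convex enough,
    as a function of the logarithm of t, only where t > eta; the functions to
    which it is applied vanish for t <= 2 eta. *)
Definition shifted_inv (t : R) : R := (t + eta)^-1.

Lemma is_derive_shifted_inv (t : R) : 0 <= t ->
  is_derive t 1 shifted_inv (- shifted_inv t ^+ 2).
Proof.
move=> t0; have H : t + eta != 0 by rewrite gt_eqF// ltr_wpDl.
have Hd : is_derive t 1 (fun s : R => s + eta) 1.
  have -> : (fun s : R => s + eta) = id + cst eta by [].
  by apply: is_derive_eq; rewrite addr0.
have := @is_deriveV R (fun s : R => s + eta) t _ _ H Hd; rewrite /shifted_inv exprVn => Hv.
by apply: is_derive_eq Hv _; rewrite [LHS]mulr1.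
Qed.

Lemma continuous_shifted_inv (t : R) : 0 <= t -> {for t, continuous shifted_inv}.
Proof.
by move=> t0; have [d _] := is_derive_shifted_inv t0;
   exact/differentiable_continuous/derivable1_diffP.
Qed.

Definition carleman_weight (t : R) : R := expR (tau * shifted_inv t).

Lemma is_derive_carleman_weight (t : R) : 0 <= t ->
  is_derive t 1 carleman_weight
    (- (tau * shifted_inv t ^+ 2) * carleman_weight t).
Proof.
move=> t0; have Hj := is_derive_shifted_inv t0.
have Hm : is_derive t 1 (tau *: shifted_inv) (tau *: (- shifted_inv t ^+ 2)).
  by apply: is_derive_eq.
have := @is_derive1_comp _ (@expR R) (tau *: shifted_inv) t _ _ (is_derive_expR _) Hm.
move=> H; apply: is_derive_eq H _; rewrite /carleman_weight.
rewrite mulrC; congr (_ * _).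
by rewrite [LHS]mulrN.
Qed.

Lemma continuous_carleman_weight (t : R) : 0 <= t -> {for t, continuous carleman_weight}.
Proof.
by move=> t0; have [d _] := is_derive_carleman_weight t0;
   exact/differentiable_continuous/derivable1_diffP.
Qed.

(** This is the derivative of the exponent tau / (t + eta) along the Euler field,
    which acts on functions of the squared distance t as 2 t d/dt. *)
Definition carleman_shift (t : R) : R := - (2 * tau) * (t * shifted_inv t ^+ 2).

Lemma is_derive_carleman_shift (t : R) : 0 <= t ->
  is_derive t 1 carleman_shift (2 * tau * ((t - eta) * shifted_inv t ^+ 3)).
Proof.
move=> t0; have Hj := is_derive_shifted_inv t0.
have -> : carleman_shift = - (2 * tau) *: (id * shifted_inv ^+ 2) by [].
apply: is_derive_eq.
have ne : t + eta != 0 by rewrite gt_eqF// ltr_wpDl.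
rewrite exprfctE /shifted_inv /GRing.scale /=.
by field.
Qed.

Lemma continuous_carleman_shift_derivative (t : R) : 0 <= t ->
  {for t, continuous (fun s : R => 2 * tau * ((s - eta) * shifted_inv s ^+ 3))}.
Proof.
move=> t0; have cj := continuous_shifted_inv t0.
have c0 : {for t, continuous (fun s : R => s - eta)}.
  apply: (@for_continuousD R R R (fun s => s) (fun=> - eta)).
    exact: cvg_id.
  exact: cst_continuous.
have c3 : {for t, continuous (fun s : R => shifted_inv s * shifted_inv s * shifted_inv s)}.
  exact: (for_continuousM (for_continuousM cj cj) cj).
have -> : (fun s : R => 2 * tau * ((s - eta) * shifted_inv s ^+ 3)) =
  (fun s : R => 2 * tau * ((s - eta) * (shifted_inv s * shifted_inv s * shifted_inv s))).
  by apply/funext => s; ring.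
apply: for_continuousM; first exact: cst_continuous.
exact: for_continuousM.
Qed.

End Weights.

(** * Unique continuation in a ball *)

Section BallUniqueness.
Variables (R : realType) (b c : R).
Hypothesis bc1 : b ^+ 2 + c ^+ 2 = 1.
Local Notation T := 'rV[R]_3.
Local Notation e a := (delta_mx 0 a : 'rV[R]_3).

Lemma continuous_sqr_dist : continuous (@sqr_dist R).
Proof. by move=> x; exact: (C1_continuous openT (C1_sqr_dist openT) (I : setT x)). Qed.

Lemma open_sqr_dist_lt (s : R) : open [set x : T | sqr_dist x < s].
Proof.
apply: (@open_comp _ _ (@sqr_dist R) [set t : R | t < s]); last exact: open_lt.
by move=> x _; exact: continuous_sqr_dist.
Qed.

Lemma open_sqr_dist_gt (s : R) : open [set x : T | s < sqr_dist x].
Proof.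
apply: (@open_comp _ _ (@sqr_dist R) [set t : R | s < t]); last exact: open_gt.
by move=> x _; exact: continuous_sqr_dist.
Qed.

Lemma coord_sqr_le (x : T) a : x 0 a * x 0 a <= sqr_dist x.
Proof.
have H (i : 'I_3) : 0 <= x 0 i * x 0 i by rewrite -expr2 sqr_ge0.
have := H 0; have := H 1; have := H 2.
by move: a; apply: ord3P; rewrite /sqr_dist; lra.
Qed.

(** The product rule for a radial factor, with m and dm the values of the factor
    and of its derivative with respect to the squared distance. *)
Lemma dirac_scale (x0 x1 x2 m dm : R) (d0 d1 d2 u : quat R) :
  (m *: d0 + (dm * (2 * x0)) *: u) + qi * (m *: d1 + (dm * (2 * x1)) *: u) +
    mkquat 0 0 b c * (m *: d2 + (dm * (2 * x2)) *: u) =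
  m *: (d0 + qi * d1 + mkquat 0 0 b c * d2) +
    (2 * dm) *: (mkquat x0 x1 (x2 * b) (x2 * c) * u).
Proof. by apply: quatP; rewrite /qi !mulqE !quatE; ring. Qed.

Variables (u : T -> quat R) (R2 eta : R).
Let U := [set x : T | sqr_dist x < R2].
Hypotheses (eta0 : 0 < eta) (Cu : C1 U u) (Du : forall x, U x -> dirac b c u x = 0).

Let oU : open U. Proof. exact: open_sqr_dist_lt. Qed.

Section Cutoff.
Variable s2 : R.
Hypotheses (s20 : 0 < s2) (s2R : s2 < R2).

Definition cutoff (s : R) : R := Num.max 0 (s2 - s).

Lemma is_derive_cutoff_sqr (t : R) :
  is_derive t 1 (fun s => pos_sqr (s2 - s)) (- (2 * cutoff t)).
Proof.
have H : is_derive t 1 (fun s : R => s2 - s) (-1).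
  have -> : (fun s : R => s2 - s) = cst s2 - id by [].
  by apply: is_derive_eq; rewrite sub0r.
have := @is_derive1_comp _ (@pos_sqr R) (fun s : R => s2 - s) t _ _ (is_derive_pos_sqr _) H.
by move=> H2; apply: is_derive_eq H2 _; rewrite mulrN1.
Qed.

Lemma continuous_cutoff : continuous cutoff.
Proof.
move=> t; apply: (@continuous_comp _ _ _ (fun s : R => s2 - s) (fun s : R => Num.max 0 s)).
  apply: (@for_continuousD R R R (fun=> s2) (fun s => - s)).
    exact: cst_continuous.
  exact: oppr_continuous.
exact: continuous_max0.
Qed.

Lemma cutoff0 s : s2 <= s -> cutoff s = 0.
Proof. by move=> H; rewrite /cutoff max_l// subr_le0. Qed.

Definition cut_sqnorm (x : T) : R :=
  pos_sqr (s2 - sqr_dist x) * dotq (u x) (u x).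

Let U' := [set x : T | s2 < sqr_dist x].
Let oU' : open U'. Proof. exact: open_sqr_dist_gt. Qed.

Lemma cut_cover x : U x \/ U' x.
Proof.
rewrite /U /U' /=; case: (ltP (sqr_dist x) R2) => [|H]; first by left.
by right; exact: lt_le_trans H.
Qed.

Lemma continuous_cut_sqnorm : continuous cut_sqnorm.
Proof.
suff H : C1 setT cut_sqnorm by move=> x; exact: (C1_continuous openT H (I : setT x)).
apply: (C1_cover cut_cover).
  apply: (C1M oU); last exact: (C1_dotq oU Cu).
  apply: (@C1_comp R 3 U (fun s => pos_sqr (s2 - s)) (fun t => - (2 * cutoff t)) _ oU).
  - by move=> x _; exact: is_derive_cutoff_sqr.
  - move=> x _; apply: continuousN; apply: for_continuousM; first exact: cst_continuous.
    exact: continuous_cutoff.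
  exact: C1_sqr_dist.
apply: (C1_eq oU' (g := fun=> 0)); last exact: C1_cst.
by move=> x /ltW /cutoff0; rewrite /cut_sqnorm /pos_sqr /cutoff => ->; rewrite expr0n mul0r.
Qed.

Lemma cut_sqnorm_ge0 x : 0 <= cut_sqnorm x.
Proof. by rewrite mulr_ge0 ?dotq_ge0// sqr_ge0. Qed.

(** The Carleman identity for the product of u by the weight and by the cutoff.
    As the Dirac operator kills u, it only sees the radial factor.  The function
    k of the identity is the derivative of the exponent along the Euler field and
    cancels the derivative of the weight.  In the parentheses the first term
    comes from the derivative of the cutoff, the second one from that of k. *)
Lemma weighted_carleman (tau : R) :
  exists2 G : T -> R, negligible (s2 + 2) G &
    forall x, G x <= carleman_weight tau eta (sqr_dist x) ^+ 2 *
      (16 * sqr_dist x ^+ 2 -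
       2 * sqr_dist x * (2 * tau * ((sqr_dist x - eta) * shifted_inv eta (sqr_dist x) ^+ 3))
         * cutoff (sqr_dist x) ^+ 2) * cut_sqnorm x.
Proof.
pose m (s : R) : R := carleman_weight tau eta s * pos_sqr (s2 - s).
pose dm (s : R) : R := carleman_weight tau eta s * (- (2 * cutoff s)) +
  pos_sqr (s2 - s) * (- (tau * shifted_inv eta s ^+ 2) * carleman_weight tau eta s).
have Hm (t : R) : 0 <= t -> is_derive t 1 m (dm t).
  move=> t0.
  exact: (@is_deriveM _ _ (carleman_weight tau eta) (fun s => pos_sqr (s2 - s)) t 1 _ _
    (is_derive_carleman_weight tau eta0 t0) (is_derive_cutoff_sqr t)).
have cdm (t : R) : 0 <= t -> {for t, continuous dm}.
  move=> t0.
  have cw := @continuous_carleman_weight R tau eta eta0 t t0.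
  have cj := @continuous_shifted_inv R eta eta0 t t0.
  have cp : {for t, continuous (fun s => pos_sqr (s2 - s))}.
    by have [d _] := is_derive_cutoff_sqr t; exact/differentiable_continuous/derivable1_diffP.
  have cc : {for t, continuous (fun s => - (2 * cutoff s))}.
    apply: continuousN; apply: for_continuousM; first exact: cst_continuous.
    exact: continuous_cutoff.
  have cj2 : {for t, continuous (fun s => - (tau * shifted_inv eta s ^+ 2))}.
    apply: continuousN; apply: for_continuousM; first exact: cst_continuous.
    exact: (for_continuousM cj cj).
  exact: (for_continuousD (for_continuousM cw cc) (for_continuousM cp (for_continuousM cj2 cw))).
pose v (x : T) : quat R := m (sqr_dist x) *: u x.
have v0 x : s2 <= sqr_dist x -> v x = 0.
  by move=> /cutoff0; rewrite /v /m /pos_sqr /cutoff => ->; rewrite expr0n mulr0 scale0r.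
have Cm V : open V -> C1 V (fun x : T => m (sqr_dist x)).
  move=> oV; apply: (@C1_comp R 3 V m dm _ oV).
  - by move=> x _; exact: Hm (sqr_dist_ge0 x).
  - by move=> x _; exact: cdm (sqr_dist_ge0 x).
  exact: C1_sqr_dist.
have CvU : C1 U v := C1Z oU (C1_quat_continuous oU Cu) (Cm U oU) Cu.
have CvU' : C1 U' v.
  apply: (C1_eq oU' (g := fun=> 0)); last exact: C1_cst.
  by move=> x /ltW /v0.
have Cv : C1 setT v := C1_cover cut_cover CvU CvU'.
have Dv x : paravector_conj b c x * dirac b c v x = (2 * sqr_dist x * dm (sqr_dist x)) *: u x.
  case: (ltP (sqr_dist x) R2) => [Ux|xR].
    have D a : 'D_(e a) v x = m (sqr_dist x) *: 'D_(e a) u x + (dm (sqr_dist x) * (2 * x 0 a)) *: u x.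
      have dmx := C1_derivable x a (Cm U oU) Ux.
      have dux := C1_derivable x a Cu Ux.
      have [_ ->] := is_derive_scale dmx dux.
      have ds := C1_derivable x a (C1_sqr_dist openT) I.
      by rewrite (derive_comp1 (Hm _ (sqr_dist_ge0 x)) ds) derive_sqr_dist.
    rewrite /dirac !D dirac_scale -/(dirac b c u x) Du// scaler0 add0r.
    rewrite -scalerAr (slice_paravector_norm _ _ _ _ bc1) scalerA.
    by rewrite mulrAC.
  have s2x : s2 < sqr_dist x by exact: lt_le_trans xR.
  have D a : 'D_(e a) v x = 0.
    rewrite (@near_eq_derive _ _ _ v (fun=> 0) x (e a)) ?derive_cst//.
    have : nbhs x U' by exact: open_nbhs_nbhs.
    by apply: filterS => y /ltW /v0.
  rewrite /dirac !D !mulr0 !addr0 mulr0.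
  have c0 := cutoff0 (ltW s2x).
  rewrite /dm c0 /pos_sqr; move: (c0); rewrite /cutoff => ->.
  by rewrite expr0n mul0r !mulr0 oppr0 !mulr0 addr0 mulr0 scale0r.
have sv (x : T) i : s2 + 1 <= `|x 0 i| -> v x = 0.
  move=> xi; apply: v0; apply: le_trans (coord_sqr_le x i).
  have -> : x 0 i * x 0 i = `|x 0 i| * `|x 0 i| by rewrite -normrM ger0_norm// -expr2 sqr_ge0.
  nra.
have M0 : 0 < s2 + 2 by rewrite addr_gt0.
have rM : s2 + 1 < s2 + 2 by rewrite ltrD2l ltr1n.
have [G NG HG] := carleman_identity M0 rM bc1 sv Cv
  (fun t t0 => @is_derive_carleman_shift R tau eta eta0 t t0)
  (fun t t0 => @continuous_carleman_shift_derivative R tau eta eta0 t t0).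
exists G => // x; move: (HG x _ erefl).
rewrite Dv /v scalerA -scalerBl !(dotqZl, dotqZr).
set s := sqr_dist x; set w := carleman_weight tau eta s; set q := dotq (u x) (u x).
(* The derivative of the weight cancels here against the shift. *)
have E1 : 2 * s * dm s - carleman_shift tau eta s * m s = - (4 * s * w * cutoff s).
  rewrite /dm /m /carleman_shift -/w /pos_sqr -/(cutoff s); ring.
rewrite E1 => H; rewrite -lerBrDr in H; apply: le_trans H _.
rewrite le_eqVlt; apply/orP; left; apply/eqP.
rewrite /m -/w /cut_sqnorm /pos_sqr -/s -/(cutoff s) -/q; ring.
Qed.

End Cutoff.
End BallUniqueness.

Section ShiftedInverse.
Variables (R : realType) (eta : R).
Hypothesis eta0 : 0 < eta.

Lemma shifted_inv_gt0 (s : R) : 0 <= s -> 0 < shifted_inv eta s.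
Proof. by move=> s0; rewrite invr_gt0 ltr_wpDl. Qed.

Lemma shifted_inv_le (s t : R) : 0 <= s -> s <= t -> shifted_inv eta t <= shifted_inv eta s.
Proof.
move=> s0 st; have t0 : 0 <= t by exact: le_trans st.
by rewrite lef_pV2 ?posrE ?ltr_wpDl ?lerD2r.
Qed.

Lemma shifted_inv_lt (s t : R) : 0 <= s -> s < t -> shifted_inv eta t < shifted_inv eta s.
Proof.
move=> s0 st; have t0 : 0 <= t by exact: le_trans (ltW st).
by rewrite ltf_pV2 ?ltrD2r ?posrE ?ltr_wpDl.
Qed.

Lemma carleman_weight_le (tau s t : R) : 0 <= tau -> 0 <= s -> s <= t ->
  carleman_weight tau eta t <= carleman_weight tau eta s.
Proof.
by move=> tau0 s0 st; rewrite ler_expR ler_wpM2l// shifted_inv_le.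
Qed.

End ShiftedInverse.

Section StrongUniqueContinuation.
Variables (R : realType) (b c : R).
Hypothesis bc1 : b ^+ 2 + c ^+ 2 = 1.
Local Notation T := 'rV[R]_3.

(** If u(y) is nonzero, compare the two sides of the weighted Carleman inequality
    as tau grows.  For squared distances below s1 the term with tau dominates the
    one coming from the derivative of the cutoff and the right-hand side is
    negative, by at least a multiple of the square of the weight at s3 near y.
    Beyond s1 it is at most a multiple of the square of the weight at s1.  Since
    s3 < s1 and the weight decreases, the negative part wins for large tau, and
    the Riemann sums of G stay below a negative number instead of tending to 0. *)
Lemma monogenic_ball_unique (u : T -> quat R) (R2 eta : R) :
  0 < eta -> C1 [set x | sqr_dist x < R2] u ->
  (forall x, sqr_dist x < R2 -> dirac b c u x = 0) ->
  (forall x, sqr_dist x <= 2 * eta -> u x = 0) ->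
  forall y, sqr_dist y < R2 -> u y = 0.
Proof.
move=> eta0 Cu Du u0 y Uy; apply/eqP; case: (eqVneq (u y) 0) => // uy0; exfalso.
set sy := sqr_dist y in Uy.
have sy_eta : 2 * eta < sy.
  by rewrite ltNge; apply: contraNN uy0 => /u0 ->.
(* The interval from sy to R2 is cut at s3 (where the neighbourhood of y ends), s1
   (where the good region ends) and s2 (where the cutoff ends). *)
pose d := (R2 - sy) / 6.
have d0 : 0 < d by rewrite divr_gt0// subr_gt0.
have Rd : R2 = sy + 6 * d by rewrite /d mulrC divfK// addrC subrK.
pose s1 := sy + 2 * d; pose s2 := sy + 3 * d; pose s3 := sy + d.
have sy0 : 0 < sy by apply: lt_trans sy_eta; rewrite mulr_gt0.
have s20 : 0 < s2 by rewrite addr_gt0// mulr_gt0.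
have s10 : 0 < s1 by rewrite addr_gt0// mulr_gt0.
have s30 : 0 < s3 by rewrite addr_gt0.
have s2R : s2 < R2 by rewrite Rd ltrD2l ltr_pM2r// ltr_nat.
have s12 : s1 < s2 by rewrite ltrD2l ltr_pM2r// ltr_nat.
have s31 : s3 < s1 by rewrite ltrD2l ltr_pMl// ltr1n.
pose w := cut_sqnorm u s2; pose M := s2 + 2.
have M0 : 0 < M by rewrite addr_gt0.
have w_ge0 x : 0 <= w x by exact: cut_sqnorm_ge0.
have cw : continuous w := continuous_cut_sqnorm Cu s2R.
have wE x : w x = cutoff s2 (sqr_dist x) ^+ 2 * dotq (u x) (u x) by [].
pose om := w y / 2.
have om0 : 0 < om.
  rewrite divr_gt0// wE mulr_gt0// ?dotq_gt0// exprn_gt0//.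
  by rewrite /cutoff lt_max subr_gt0 -/sy ltrDl mulr_gt0 ?orbT.
have [r1 r10 Hr1] := (continuous_ballP w y).1 (cw y) _ om0.
have [r2 r20 Hr2] := (continuous_ballP (@sqr_dist R) y).1 (@continuous_sqr_dist R y) _ d0.
pose rho := Num.min 1 (Num.min r1 r2) / 2.
have rmin : 0 < Num.min 1 (Num.min r1 r2) by rewrite !lt_min ltr01 r10.
have rho0 : 0 < rho by rewrite divr_gt0.
have rhol : rho < Num.min 1 (Num.min r1 r2) by rewrite /rho ltr_pdivrMr// ltr_pMr// ltr1n.
move: (rhol); rewrite !lt_min => /and3P[rho1 rhor1 rhor2].
have near_w x : `|x - y| <= rho -> om <= w x.
  rewrite distrC => H; have := Hr1 x (le_lt_trans H rhor1).
  have : w y = 2 * om by rewrite /om mulrC divfK.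
  by move=> ->; rewrite ler_norml => /andP[_]; clear; lra.
have near_s x : `|x - y| <= rho -> sqr_dist x <= s3.
  rewrite distrC => H; have := Hr2 x (le_lt_trans H rhor2).
  by rewrite ler_norml => /andP[+ _]; rewrite /s3 -/sy; clear; lra.
have [B B0 HB] := bounded_box M cw.
pose j := shifted_inv eta.
have j0 s : 0 <= s -> 0 < j s by exact: shifted_inv_gt0.
pose c0 := 2 * eta * eta * j s2 ^+ 3.
have c00 : 0 < c0 by rewrite !mulr_gt0 ?exprn_gt0 ?j0// ltW.
pose gap := j s3 - j s1.
have gap0 : 0 < gap by rewrite subr_gt0 shifted_inv_lt// ltW.
pose K := (2 * M) ^+ 3 * (16 * s2 ^+ 2 * B).
have K0 : 0 <= K by rewrite !mulr_ge0 ?exprn_ge0 ?mulr_ge0// ltW.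
pose ka := (rho / 2) ^+ 3 * om.
have ka0 : 0 < ka by rewrite /ka mulr_gt0// exprn_gt0// divr_gt0.
(* tau1 makes the good term dominate below s1, tau2 makes the ratio of the weights
   at s3 and s1 large enough. *)
pose tau1 := (16 * s2 ^+ 2 + 1) / (4 * c0 * d ^+ 2).
pose tau2 := (K + 1) / (2 * gap * ka).
have den1 : 0 < 4 * c0 * d ^+ 2.
  by apply: mulr_gt0; [apply: mulr_gt0|apply: exprn_gt0].
have den2 : 0 < 2 * gap * ka by apply: mulr_gt0 => //; apply: mulr_gt0.
have tau10 : 0 < tau1 by rewrite divr_gt0// ltr_wpDl// mulr_ge0// sqr_ge0.
have tau20 : 0 < tau2 by rewrite divr_gt0// ltr_wpDl.
pose tau := tau1 + tau2.
have tau0 : 0 < tau by rewrite addr_gt0.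
have Htau1 : 16 * s2 ^+ 2 - 4 * tau * c0 * d ^+ 2 <= -1.
  have : tau1 * (4 * c0 * d ^+ 2) <= tau * (4 * c0 * d ^+ 2).
    by rewrite ler_wpM2r ?(ltW den1)// lerDl ltW.
  rewrite {1}/tau1 divfK ?gt_eqF// => H.
  have -> : 4 * tau * c0 * d ^+ 2 = tau * (4 * c0 * d ^+ 2) by ring.
  by move: H; clear; lra.
pose W s := carleman_weight tau eta s.
have W0 s : 0 < W s by exact: expR_gt0.
have W_le s t : 0 <= s -> s <= t -> W t ^+ 2 <= W s ^+ 2.
  move=> s0 st; rewrite lerXn2r ?nnegrE ?(ltW (W0 _))//.
  by apply: carleman_weight_le => //; exact: ltW.
have Wgap : W s1 ^+ 2 * (K + 1) <= W s3 ^+ 2 * ka.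
  have -> : W s3 ^+ 2 = W s1 ^+ 2 * expR (2 * tau * gap).
    rewrite -!expRM_natl -expRD; congr expR; rewrite -/(j s1) -/(j s3) /gap; ring.
  rewrite -mulrA ler_wpM2l ?sqr_ge0//.
  apply: (@le_trans _ _ (2 * tau * gap * ka)).
    have : tau2 * (2 * gap * ka) <= tau * (2 * gap * ka).
      by rewrite ler_wpM2r ?(ltW den2)// lerDr ltW.
    rewrite {1}/tau2 divfK ?gt_eqF// => H; apply: le_trans H _.
    by rewrite le_eqVlt; apply/orP; left; apply/eqP; ring.
  rewrite ler_wpM2r ?(ltW ka0)//.
  by apply: le_trans (expR_ge1Dx _); rewrite lerDr.
have [G NG HG] := weighted_carleman bc1 eta0 Cu Du s20 s2R tau.
rewrite -/M in NG.
pose ind (x : T) : R := if `|x - y| <= rho then 1 else 0.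
have HF (x : T) : `|x| <= M ->
    G x <= W s1 ^+ 2 * (16 * s2 ^+ 2 * B) + - (W s3 ^+ 2 * om) * ind x.
  move=> xM; apply: le_trans (HG x) _.
  set s := sqr_dist x; have s0 : 0 <= s by exact: sqr_dist_ge0.
  rewrite -/(W s) -/(w x) -/(j s).
  have R0 : 0 <= W s1 ^+ 2 * (16 * s2 ^+ 2 * B).
    apply: mulr_ge0; first exact: sqr_ge0.
    by apply: mulr_ge0 => //; apply: mulr_ge0 => //; exact: sqr_ge0.
  have zero_case : w x = 0 -> W s ^+ 2 * (16 * s ^+ 2 -
      2 * s * (2 * tau * ((s - eta) * j s ^+ 3)) * cutoff s2 s ^+ 2) * w x <=
      W s1 ^+ 2 * (16 * s2 ^+ 2 * B) + - (W s3 ^+ 2 * om) * ind x.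
    move=> wx0; rewrite wx0 mulr0 /ind; case: ifP => [/near_w|_].
      by rewrite wx0 leNgt om0.
    by rewrite mulr0 addr0.
  case: (leP s (2 * eta)) => [s_eta|eta_s].
    by apply: zero_case; rewrite wE u0// dotq0l mulr0.
  case: (leP s2 s) => [s2s|ss2].
    by apply: zero_case; rewrite wE cutoff0// expr0n mul0r.
  have eta_le : eta <= s - eta by move: eta_s; clear; lra.
  have wxB : w x <= B by apply: le_trans (HB x xM); exact: ler_norm.
  have js : 0 < j s by exact: j0.
  case: (leP s s1) => [ss1|s1s].
    have cut : d <= cutoff s2 s.
      rewrite /cutoff le_max; apply/orP; right; move: ss1; rewrite /s1 /s2; clear; lra.
    have jle : j s2 ^+ 3 <= j s ^+ 3.
      by rewrite lerXn2r ?nnegrE ?(ltW (j0 _ _))// ?(ltW s20)// shifted_inv_le// ltW.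
    have P1 : c0 <= s * ((s - eta) * j s ^+ 3).
      have -> : c0 = (2 * eta) * (eta * j s2 ^+ 3) by rewrite /c0; ring.
      have j2 : 0 <= j s2 ^+ 3 by apply: exprn_ge0; rewrite ltW// j0// ltW.
      have e2 : 0 <= 2 * eta by rewrite mulr_ge0// ltW.
      apply: ler_pM => //; [by apply: mulr_ge0 => //; exact: ltW|exact: ltW|].
      by apply: ler_pM => //; exact: ltW.
    have P2 : d ^+ 2 <= cutoff s2 s ^+ 2.
      by rewrite lerXn2r ?nnegrE ?(ltW d0)//; apply: le_trans cut; exact: ltW.
    have P3 : c0 * d ^+ 2 <= s * ((s - eta) * j s ^+ 3) * cutoff s2 s ^+ 2.
      by apply: ler_pM; rewrite ?sqr_ge0 ?(ltW c00).
    have P4 : s ^+ 2 <= s2 ^+ 2 by rewrite lerXn2r ?nnegrE ?(ltW s20) ?(ltW ss2).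
    have P5 : 16 * s ^+ 2 - 2 * s * (2 * tau * ((s - eta) * j s ^+ 3)) * cutoff s2 s ^+ 2 <= -1.
      have P6 : 4 * tau * (c0 * d ^+ 2) <= 4 * tau * (s * ((s - eta) * j s ^+ 3) * cutoff s2 s ^+ 2).
        by rewrite ler_wpM2l// mulr_ge0// ltW.
      apply: le_trans Htau1.
      have -> : 2 * s * (2 * tau * ((s - eta) * j s ^+ 3)) * cutoff s2 s ^+ 2 =
         4 * tau * (s * ((s - eta) * j s ^+ 3) * cutoff s2 s ^+ 2) by ring.
      have -> : 4 * tau * c0 * d ^+ 2 = 4 * tau * (c0 * d ^+ 2) by ring.
      by apply: lerB => //; rewrite ler_wpM2l.
    have P7 : W s ^+ 2 * (16 * s ^+ 2 -
      2 * s * (2 * tau * ((s - eta) * j s ^+ 3)) * cutoff s2 s ^+ 2) * w x <= - (W s ^+ 2 * w x).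
      rewrite mulrAC -[leRHS]mulrN1; apply: ler_wpM2l => //.
      by apply: mulr_ge0 => //; exact: sqr_ge0.
    apply: le_trans P7 _; rewrite /ind; case: ifP => [xy|_]; last first.
      rewrite mulr0 addr0; apply: le_trans R0.
      by rewrite oppr_le0; apply: mulr_ge0 => //; exact: sqr_ge0.
    rewrite mulr1 -[leLHS]add0r lerD// lerN2.
    apply: ler_pM; rewrite ?sqr_ge0 ?(ltW om0)//; last exact: near_w.
    by apply: W_le => //; exact: near_s.
  have -> : ind x = 0.
    rewrite /ind; case: ifP => // /near_s; rewrite -/s leNgt.
    by rewrite (lt_trans s31 s1s).
  rewrite mulr0 addr0 -mulrA.
  apply: (@le_trans _ _ (W s ^+ 2 * (16 * s2 ^+ 2 * B))); last first.
    apply: ler_wpM2r; last by apply: W_le; exact: ltW.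
    by apply: mulr_ge0 => //; apply: mulr_ge0 => //; exact: sqr_ge0.
  rewrite ler_wpM2l ?sqr_ge0//.
  apply: (@le_trans _ _ (16 * s2 ^+ 2 * w x)); last first.
    by apply: ler_wpM2l => //; apply: mulr_ge0 => //; exact: sqr_ge0.
  rewrite ler_wpM2r//.
  have P4 : s ^+ 2 <= s2 ^+ 2 by rewrite lerXn2r ?nnegrE ?(ltW s20) ?(ltW ss2).
  have P5 : 0 <= 2 * s * (2 * tau * ((s - eta) * j s ^+ 3)) * cutoff s2 s ^+ 2.
    have se : 0 <= s - eta by apply: le_trans eta_le; exact: ltW.
    have js3 : 0 <= j s ^+ 3 by apply: exprn_ge0; exact: ltW.
    have tt : 0 <= 2 * tau by rewrite mulr_ge0// ltW.
    apply: mulr_ge0; last exact: sqr_ge0.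
    by apply: mulr_ge0; [exact: mulr_ge0|apply: mulr_ge0 => //; exact: mulr_ge0].
  by move: P4 P5; clear; lra.
have yM a : `|y ord0 a| + rho < M.
  have H : `|y 0 a| < s2 + 1.
    rewrite ltNge; apply/negP => H.
    have := coord_sqr_le y a.
    have -> : y 0 a * y 0 a = `|y 0 a| * `|y 0 a| by rewrite -normrM ger0_norm// -expr2 sqr_ge0.
    have : sqr_dist y < s2 by rewrite -/sy /s2 ltrDl mulr_gt0.
    by move: H s20; clear; nra.
  by rewrite /M; move: H rho1; clear; lra.
have ev1 := riemann_sum_ball M0 rho0 yM.
have W10 : 0 < W s1 ^+ 2 by rewrite exprn_gt0.
have ev2 : \forall N \near \oo, `|riemann_sum M G N| < W s1 ^+ 2.
  have /cvgrPdist_lt /(_ _ W10) := NG.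
  by apply: filterS => N; rewrite sub0r normrN.
have [N [HN1 HN2]] : exists N, (rho / 2) ^+ 3 <= riemann_sum M ind N /\ `|riemann_sum M G N| < W s1 ^+ 2.
  have [N0 _ H] := filterI ev1 ev2.
  by exists N0; apply: (H N0) => /=.
have := riemann_sum_le M0 N HF.
rewrite (riemann_sumD M (fun=> W s1 ^+ 2 * (16 * s2 ^+ 2 * B)) (fun x => - (W s3 ^+ 2 * om) * ind x)).
rewrite (riemann_sumZ M (- (W s3 ^+ 2 * om)) ind) riemann_sum_cst => Hle.
have H1 : W s3 ^+ 2 * ka <= W s3 ^+ 2 * om * riemann_sum M ind N.
  rewrite -mulrA; apply: ler_wpM2l; first exact: sqr_ge0.
  by rewrite /ka mulrC; apply: ler_wpM2l => //; exact: ltW.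
have H2 : (2 * M) ^+ 3 * (W s1 ^+ 2 * (16 * s2 ^+ 2 * B)) = W s1 ^+ 2 * K.
  by rewrite /K mulrCA.
move: HN2; rewrite ltr_norml => /andP[HN2 _].
rewrite H2 mulNr in Hle; rewrite mulrDr mulr1 in Wgap.
by move: Wgap Hle H1 HN2; clear; lra.
Qed.

End StrongUniqueContinuation.

(** * The identity principle *)

Section IdentityPrinciple.
Variables (R : realType) (b c : R).
Hypothesis bc1 : b ^+ 2 + c ^+ 2 = 1.
Local Notation T := 'rV[R]_3.
Local Notation e a := (delta_mx 0 a : 'rV[R]_3).

Lemma norm_le_sqr_dist (x : T) (k : R) : 0 <= k -> sqr_dist x <= k ^+ 2 -> `|x| <= k.
Proof.
move=> k0 H; apply: norm_rV_le => // i.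
have : `|x 0 i| ^+ 2 <= k ^+ 2.
  by rewrite real_normK ?num_real//; apply: le_trans H; rewrite expr2; exact: coord_sqr_le.
by rewrite ler_pXn2r// nnegrE.
Qed.

Lemma sqr_dist_le_norm (x : T) : sqr_dist x <= 3 * `|x| ^+ 2.
Proof.
have H i : x 0 i * x 0 i <= `|x| ^+ 2.
  rewrite -expr2 -[leLHS]real_normK ?num_real//.
  by rewrite lerXn2r ?nnegrE//; exact: norm_coord.
by have := H 0; have := H 1; have := H 2; rewrite /sqr_dist; lra.
Qed.

Lemma is_derive_translate (W : normedModType R) (f : T -> W) (a x v : T) :
  derivable f (x + a) v -> is_derive x v (fun y => f (y + a)) ('D_v f (x + a)).
Proof.
have E : (fun h : R => h^-1 *: (((fun y => f (y + a)) \o shift x) (h *: v) - f (x + a))) =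
   (fun h => h^-1 *: ((f \o shift (x + a)) (h *: v) - f (x + a))).
  by apply/funext => h /=; rewrite addrA.
by move=> df; apply: DeriveDef; [rewrite /derivable E|rewrite /derive E].
Qed.

(** In the ball of radius eps / 2 around a the function vanishes near the centre,
    hence everywhere, and this ball contains a neighbourhood of p. *)
Lemma monogenic_propagation (u : T -> quat R) (p a : T) (eps : R) :
  C1 [set x | `|x - p| < eps] u ->
  (forall x, `|x - p| < eps -> dirac b c u x = 0) ->
  `|a - p| < eps / 4 -> (\near a, u a = 0) -> \near p, u p = 0.
Proof.
move=> Cu Du ap /nbhs_normP[d d0 Hd].
have eps0 : 0 < eps by have := le_lt_trans (normr_ge0 _) ap; rewrite pmulr_lgt0.
pose v (x : T) : quat R := u (x + a).
pose R2 := (eps / 2) ^+ 2.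
pose eta := (d / 2) ^+ 2 / 2.
have eta0 : 0 < eta by rewrite divr_gt0// exprn_gt0// divr_gt0.
have inball (x : T) : sqr_dist x < R2 -> `|x + a - p| < eps.
  move=> /ltW /norm_le_sqr_dist H.
  have {}H : `|x| <= eps / 2 by apply: H; rewrite divr_ge0// ltW.
  rewrite -addrA; apply: le_lt_trans (ler_normD _ _) _; move: H ap eps0; clear; lra.
have DE i (x : T) : sqr_dist x < R2 -> is_derive x (e i) v ('D_(e i) u (x + a)).
  by move=> /inball H; apply: is_derive_translate; have [] := Cu i (x + a) H.
have Cv : C1 [set x : T | sqr_dist x < R2] v.
  apply: (@C1I R 3 (quat R) _ v (fun i x => 'D_(e i) u (x + a)) (@open_sqr_dist_lt R R2) DE).
  move=> i x /inball H.
  apply: (@continuous_comp _ _ _ (fun x : T => x + a) ('D_(e i) u)).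
    apply: (@for_continuousD R T T (fun x => x) (fun=> a)); first exact: cvg_id.
    exact: cst_continuous.
  by have [] := Cu i (x + a) H.
have Dv (x : T) : sqr_dist x < R2 -> dirac b c v x = 0.
  move=> H; rewrite /dirac.
  have [_ ->] := DE 0 x H; have [_ ->] := DE 1 x H; have [_ ->] := DE 2 x H.
  exact: Du (inball x H).
have v0 (x : T) : sqr_dist x <= 2 * eta -> v x = 0.
  rewrite /eta mulrC divfK// => /norm_le_sqr_dist H; apply: Hd.
  rewrite opprD addrA addrAC subrr add0r normrN.
  have : `|x| <= d / 2 by apply: H; rewrite divr_ge0// ltW.
  by move: d0; clear; lra.
have Hv := monogenic_ball_unique bc1 eta0 Cv Dv v0.
apply/nbhs_normP; exists (eps / 4 - `|a - p|); first by rewrite subr_gt0.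
move=> y py; have -> : u y = v (y - a) by rewrite /v subrK.
apply: Hv; apply: le_lt_trans (sqr_dist_le_norm _) _.
have ya : `|y - a| < eps / 4.
  have := ler_distD p y a; rewrite (distrC p a) (distrC y p).
  by move: py; clear; lra.
have : `|y - a| ^+ 2 <= (eps / 4) ^+ 2 by rewrite lerXn2r ?nnegrE// ?divr_ge0// ltW.
have : 0 < eps ^+ 2 by rewrite exprn_gt0.
by rewrite /R2 !expr_div_n; clear; lra.
Qed.

(** The projection to the closed half-space where the last coordinate is
    nonnegative.  A solution that vanishes on the boundary plane, composed with
    it, is its extension by zero across the plane. *)
Definition clip (x : T) : T := x + (Num.max 0 (x 0 2) - x 0 2) *: e 2.

Lemma clip_coord (x : T) i : clip x 0 i = if i == 2 then Num.max 0 (x 0 2) else x 0 i.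
Proof.
rewrite !mxE eqxx /=; case: eqP => [->|_] /=; last by rewrite mulr0 addr0.
by rewrite mulr1 addrC subrK.
Qed.

Lemma clip_dist (p x : T) : p 0 2 = 0 -> `|clip x - p| <= `|x - p|.
Proof.
move=> p2; apply: norm_rV_le => // i.
rewrite mxE [X in _ + X]mxE clip_coord.
have H := norm_coord (x - p) i; rewrite mxE [X in _ + X]mxE in H.
case: eqP H => [->|_] //; rewrite p2 !subr0 => H; apply: le_trans H.
by case: (leP 0 (x 0 2)) => // _; rewrite normr0.
Qed.

Lemma continuous_clip : continuous clip.
Proof.
move=> x; apply: (@for_continuousD R T T (fun y => y)
  (fun y => (Num.max 0 (y 0 2) - y 0 2) *: e 2)); first exact: cvg_id.
have c2 : {for x, continuous (fun y : T => y 0 2 : R)} by exact: coord_continuous.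
apply: (@continuousZ _ _ _ (fun y : T => Num.max 0 (y 0 2) - y 0 2) (fun=> e 2)); last exact: cst_continuous.
apply: (@for_continuousD R T R (fun y => Num.max 0 (y 0 2)) (fun y => - y 0 2)).
  exact: (@continuous_comp _ _ _ (fun y : T => y 0 2 : R) (fun s : R => Num.max 0 s) x c2 (@continuous_max0 R _)).
exact: continuousN.
Qed.

Lemma is_derive_clip_tangential (u : T -> quat R) (x : T) i : i != 2 ->
  derivable u (clip x) (e i) -> is_derive x (e i) (fun y => u (clip y)) ('D_(e i) u (clip x)).
Proof.
move=> i2.
have E : (fun h : R => h^-1 *: (((fun y => u (clip y)) \o shift x) (h *: e i) - u (clip x))) =
   (fun h => h^-1 *: ((u \o shift (clip x)) (h *: e i) - u (clip x))).
  apply/funext => h /=; congr (_ *: (u _ - _)); apply/rowP => k.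
  rewrite clip_coord [RHS]mxE clip_coord !mxE !eqxx /=.
  rewrite (_ : (2 == i) = false) ?mulr0 ?add0r; last by rewrite eq_sym (negbTE i2).
  by case: eqP => [->|_]//; rewrite (_ : (2 == i) = false) ?mulr0 ?add0r// eq_sym (negbTE i2).
by move=> df; apply: DeriveDef; [rewrite /derivable E|rewrite /derive E].
Qed.

(** The normal derivative is the one that could jump across the plane, so it is
    asked to vanish there. *)
Lemma is_derive_clip_normal (u : T -> quat R) (x : T) :
  derivable u (clip x) (e 2) -> (x 0 2 <= 0 -> 'D_(e 2) u (clip x) = 0) ->
  is_derive x (e 2) (fun y => u (clip y)) ('D_(e 2) u (clip x)).
Proof.
move=> df d0; pose x' := x - x 0 2 *: e 2.
have cE s : clip (s *: e 2 + x) = x' + Num.max 0 (s + x 0 2) *: e 2.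
  apply/rowP => k; rewrite clip_coord !mxE !eqxx /= mulr1.
  case: (eqVneq k 2) => [->|k2] /=; first by rewrite !mulr1 subrr add0r.
  by rewrite !mulr0 subr0 add0r addr0.
have cx : clip x = x' + Num.max 0 (x 0 2) *: e 2.
  by rewrite -[x in LHS]add0r -(scale0r (e 2)) cE add0r.
have Hk : is_derive (Num.max 0 (x 0 2)) 1 (fun s : R => u (x' + s *: e 2)) ('D_(e 2) u (clip x)).
  by rewrite cx; apply: is_derive_line; rewrite -cx.
have [D E] := is_derive_max0 Hk d0.
have EE : (fun h : R => h^-1 *: (((fun y => u (clip y)) \o shift x) (h *: e 2) - u (clip x))) =
   (fun h => h^-1 *: (((fun s : R => u (x' + Num.max 0 s *: e 2)) \o shift (x 0 2)) (h *: (1:R)) -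
      u (x' + Num.max 0 (x 0 2) *: e 2))).
  by apply/funext => h /=; rewrite cE -cx [h *: 1]mulr1.
by apply: DeriveDef; [rewrite /derivable EE|rewrite /derive EE].
Qed.

End IdentityPrinciple.

Section IdentityTheorem.
Variables (R : realType) (b c : R).
Hypothesis bc1 : b ^+ 2 + c ^+ 2 = 1.
Local Notation T := 'rV[R]_3.
Local Notation e a := (delta_mx 0 a : 'rV[R]_3).

Lemma open_dist_lt (p : T) (eps : R) : open [set x : T | `|x - p| < eps].
Proof.
have -> : [set x : T | `|x - p| < eps] = ball p eps.
  by apply/seteqP; split=> x; rewrite -ball_normE /= distrC.
exact: ball_open.
Qed.

Lemma slice_unit_mulI (q : quat R) : mkquat 0 0 b c * q = 0 -> q = 0.
Proof.
move=> H; have : mkquat 0 0 b c * (mkquat 0 0 b c * q) = - (b ^+ 2 + c ^+ 2) *: q.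
  by apply: quatP; rewrite !mulqE !(quatE, quatNE); ring.
by rewrite H mulr0 bc1 scaleN1r => /eqP; rewrite eq_sym oppr_eq0 => /eqP.
Qed.

(** The derivatives of u along the plane vanish on it; by the equation so does the
    normal one.  Therefore u composed with clip is again a C1 solution.  It
    vanishes on one side of the plane, hence near p, and it agrees with u on the
    other side. *)
Lemma monogenic_zero_on_plane (u : T -> quat R) (p : T) (eps : R) : 0 < eps ->
  p 0 2 = 0 -> C1 [set x | `|x - p| < eps] u ->
  (forall x, `|x - p| < eps -> dirac b c u x = 0) ->
  (forall x : T, `|x - p| < eps -> x 0 2 = 0 -> u x = 0) ->
  exists2 q, `|q - p| < eps & \near q, u q = 0.
Proof.
move=> eps0 p2 Cu Du up.
pose h (x : T) : quat R := u (clip x).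
have clip_in x : `|x - p| < eps -> `|clip x - p| < eps.
  by move=> H; apply: le_lt_trans (clip_dist _ p2) H.
have clip_plane (x : T) : x 0 2 <= 0 -> clip x 0 2 = 0.
  by move=> x2; rewrite clip_coord eqxx max_l.
have Dtan i (x : T) : i != 2 -> `|x - p| < eps -> x 0 2 = 0 -> 'D_(e i) u x = 0.
  move=> i2 xp x2.
  have dl : derivable u (x + 0 *: e i) (e i).
    by rewrite scale0r addr0; have [] := Cu i x xp.
  have := is_derive_line dl; rewrite scale0r addr0 => -[_ <-].
  rewrite (@near_eq_derive _ _ _ _ (fun=> 0)) ?derive_cst//.
  apply/nbhs_normP; exists (eps - `|x - p|); first by rewrite subr_gt0.
  move=> t; rewrite sub0r normrN => Ht; apply: up.
    rewrite addrAC; apply: le_lt_trans (ler_normD _ _) _.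
    by rewrite norm_scale_delta; move: Ht; clear; lra.
  rewrite !mxE x2 eqxx/= (_ : (2 == i) = false) ?mulr0 ?addr0//.
  by rewrite eq_sym (negbTE i2).
have Dnor (x : T) : `|x - p| < eps -> x 0 2 = 0 -> 'D_(e 2) u x = 0.
  move=> xp x2; apply: slice_unit_mulI.
  by have := Du x xp; rewrite /dirac (Dtan 0)// (Dtan 1)// mulr0 addr0 add0r.
have Dh i (x : T) : `|x - p| < eps -> is_derive x (e i) h ('D_(e i) u (clip x)).
  move=> xp; have [d _] := Cu i (clip x) (clip_in x xp).
  case: (eqVneq i 2) d => [->|i2] d; last exact: is_derive_clip_tangential.
  apply: is_derive_clip_normal => // x2.
  by apply: Dnor; [exact: clip_in|exact: clip_plane].
have Ch : C1 [set x | `|x - p| < eps] h.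
  have HI := @C1I R 3 (quat R) _ h (fun i x => 'D_(e i) u (clip x)) (@open_dist_lt p eps) Dh.
  apply: HI.
  move=> i x xp; have [_ cD] := Cu i (clip x) (clip_in x xp).
  apply: (@continuous_comp _ _ _ (@clip R) ('D_(e i) u)); last exact: cD.
  exact: continuous_clip.
have Dh0 (x : T) : `|x - p| < eps -> dirac b c h x = 0.
  move=> xp; rewrite /dirac.
  have [_ ->] := Dh 0 x xp; have [_ ->] := Dh 1 x xp; have [_ ->] := Dh 2 x xp.
  exact: Du (clip_in x xp).
(* a lies on the side where h vanishes, close enough to p for the propagation. *)
pose a : T := p - (eps / 8) *: e 2.
have a2 : a 0 2 = - (eps / 8) by rewrite !mxE !eqxx /= mulr1 p2 sub0r.
have e8 : 0 < eps / 8 by rewrite divr_gt0.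
have ap : `|a - p| = eps / 8.
  by rewrite /a addrAC subrr add0r normrN norm_scale_delta gtr0_norm.
have h0a : \near a, h a = 0.
  apply/nbhs_normP; exists (eps / 8) => // x ax.
  have xp : `|x - p| < eps.
    by have := ler_distD a x p; rewrite (distrC x a) ap; move: ax e8; clear; lra.
  have x2 : x 0 2 <= 0.
    have := norm_coord (a - x) 2; rewrite mxE [X in _ + X]mxE a2 ler_norml => /andP[+ _].
    by move: ax; clear; lra.
  by apply: up; [exact: clip_in|exact: clip_plane].
have ap4 : `|a - p| < eps / 4 by rewrite ap ltr_pM2l// ltf_pV2 ?posrE// ltr_nat.
have /nbhs_normP[d d0 Hd] := monogenic_propagation bc1 Ch Dh0 ap4 h0a.
pose r := Num.min d eps / 2.
have m0 : 0 < Num.min d eps by rewrite lt_min d0.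
have r0 : 0 < r by rewrite divr_gt0.
have rd : 2 * r <= d by rewrite /r mulrC divfK// ge_min lexx.
have re : 2 * r <= eps by rewrite /r mulrC divfK// ge_min lexx orbT.
exists (p + r *: e 2).
  by rewrite addrAC subrr add0r norm_scale_delta gtr0_norm//; move: re r0; clear; lra.
apply/nbhs_normP; exists r => // x qx.
have x2 : 0 < x 0 2.
  have := norm_coord (p + r *: e 2 - x) 2.
  rewrite mxE [X in _ + X]mxE mxE p2 !mxE !eqxx /= mulr1 add0r ler_norml => /andP[_].
  by move: qx; clear; lra.
have cx : clip x = x by rewrite /clip max_r ?subrr ?scale0r ?addr0// ltW.
have -> : u x = h x by rewrite /h cx.
apply: Hd.
have := ler_distD (p + r *: e 2) p x.
rewrite opprD addrA subrr sub0r normrN norm_scale_delta (gtr0_norm r0).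
by move: qx rd; clear; lra.
Qed.

(** The interior of the zero set is open; it is closed in V by propagation, and
    nonempty by the behaviour at the plane. *)
Lemma monogenic_identity (V : set T) (u : T -> quat R) :
  open V -> connected V -> C1 V u -> (forall x, V x -> dirac b c u x = 0) ->
  (exists2 p, V p & p 0 2 = 0) -> (forall x : T, V x -> x 0 2 = 0 -> u x = 0) ->
  forall x, V x -> u x = 0.
Proof.
move=> oV coV Cu Du [p0 Vp0 p02] u0.
have ballV x : V x -> exists2 eps : R, 0 < eps & forall y, `|y - x| < eps -> V y.
  move=> Vx; have /nbhs_normP[d d0 Hd] : nbhs x V by exact: open_nbhs_nbhs.
  by exists d => // y yx; apply: Hd; rewrite distrC.
have CuS (x : T) (eps : R) : (forall y, `|y - x| < eps -> V y) ->
    C1 [set y | `|y - x| < eps] u by move=> H i y /H Vy; exact: Cu.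
pose Z := interior [set x | u x = 0].
pose B := V `&` Z.
have BE : B = V.
  apply: coV.
  - have [eps eps0 He] := ballV p0 Vp0.
    have [q qp uq] := monogenic_zero_on_plane eps0 p02 (CuS _ _ He)
      (fun x H => Du x (He x H)) (fun x H => u0 x (He x H)).
    by exists q; split => //; exact: He.
  - by exists Z => //; exact: open_interior.
  - exists (closure B); first exact: closed_closure.
    apply/seteqP; split=> x; first by move=> Bx; split; [case: Bx|exact: subset_closure].
    move=> [Vx clx]; split => //.
    have [eps eps0 He] := ballV x Vx.
    have : nbhs x [set y | `|y - x| < eps / 4].
      apply/nbhs_normP; exists (eps / 4); first by rewrite divr_gt0.
      by move=> y; rewrite distrC.
    move=> /clx [a [[Va Za] ax]].
    exact: (monogenic_propagation bc1 (CuS _ _ He) (fun x H => Du x (He x H)) ax Za).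
move=> x Vx; have [_ Zx] : B x by rewrite BE.
exact: (nbhs_singleton Zx).
Qed.

End IdentityTheorem.

(** * Coordinates on the slices *)

Section SliceCoordinates.
Variable R : realType.
Local Notation T := 'rV[R]_3.
Local Notation e a := (delta_mx 0 a : 'rV[R]_3).
Implicit Types (I J K q z : quat R) (x : T).

Definition slice_point J (x : T) : quat R :=
  (x 0 0)%:A + x 0 1 *: qi + x 0 2 *: J.

Lemma S1E J : S1 J -> exists b c : R, b ^+ 2 + c ^+ 2 = 1 /\ J = mkquat 0 0 b c.
Proof.
move=> [b [c [bc ->]]]; exists b, c; split => //.
by apply: quatP; rewrite /qj /qk !quatE; ring.
Qed.

Lemma slice_point_scale J (h : R) (i : 'I_3) (x : T) :
  slice_point J (h *: e i + x) = h *: slice_point J (e i) + slice_point J x.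
Proof.
rewrite /slice_point !mxE !scalerDl !scalerDr !scalerA.
by rewrite [X in X + _ = _]addrACA [LHS]addrACA.
Qed.

Lemma slice_point_delta J :
  [/\ slice_point J (e 0) = 1, slice_point J (e 1) = qi & slice_point J (e 2) = J].
Proof.
by split; rewrite /slice_point !mxE /= ?scale1r ?scale0r ?addr0 ?add0r.
Qed.

Lemma continuous_slice_point J : continuous (slice_point J).
Proof.
have cc i (q : quat R) : continuous (fun x : T => x 0 i *: q).
  move=> x; apply: (@continuousZ _ _ _ (fun y : T => y 0 i : R) (fun=> q)).
    exact: coord_continuous.
  exact: cst_continuous.
move=> x; apply: (@for_continuousD R T (quat R) (fun x => (x 0 0)%:A + x 0 1 *: qi)); last exact: cc.
by apply: (@for_continuousD R T (quat R) (fun x => (x 0 0)%:A)); exact: cc.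
Qed.

Lemma is_derive_slice (f : quat R -> quat R) J (i : 'I_3) (x : T) :
  derivable f (slice_point J x) (slice_point J (e i)) ->
  is_derive x (e i) (fun y => f (slice_point J y))
    ('D_(slice_point J (e i)) f (slice_point J x)).
Proof.
have E : (fun h : R => h^-1 *: (((fun y => f (slice_point J y)) \o shift x) (h *: e i) -
      f (slice_point J x))) =
   (fun h => h^-1 *: ((f \o shift (slice_point J x)) (h *: slice_point J (e i)) -
      f (slice_point J x))).
  by apply/funext => h /=; rewrite slice_point_scale.
by move=> df; apply: DeriveDef; [rewrite /derivable E|rewrite /derive E].
Qed.

(** The set A is only relatively open in the slice; the composite is nevertheless
    continuous in the ambient sense because its argument never leaves A. *)
Lemma continuous_within_slice (W : topologicalType) (A : set (quat R)) (V : set T)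
    (F : quat R -> W) J x : open V -> (forall y, V y -> A (slice_point J y)) ->
  {within A, continuous F} -> V x ->
  {for x, continuous (fun y => F (slice_point J y))}.
Proof.
move=> oV VA cF Vx.
have /subspace_continuousP /(_ (slice_point J x) (VA x Vx)) HF := cF.
move=> P /HF; rewrite /= => HP.
have HP2 : nbhs (slice_point J x) (fun q => A q -> P (F q)) by exact: HP.
have H1 : nbhs x (fun y => A (slice_point J y) -> P (F (slice_point J y))).
  exact: (@continuous_slice_point J x _ HP2).
have H2 : nbhs x V by exact: open_nbhs_nbhs.
have : nbhs x (fun y => P (F (slice_point J y))).
  by apply: filterS2 H1 H2 => y H /VA; exact: H.
exact.
Qed.

Lemma continuous_mulq_l q : continuous (fun y : quat R => q * y).
Proof.
have E : (fun y : quat R => q * y) = (fun y : quat R => y 0 (inord 0) *: q +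
    y 0 (inord 1) *: (q * qi) + y 0 (inord 2) *: (q * qj) + y 0 (inord 3) *: (q * qk)).
  apply/funext => y; rewrite -[y 0 (inord 0)]/(re y) -[y 0 (inord 1)]/(im_i y).
  rewrite -[y 0 (inord 2)]/(im_j y) -[y 0 (inord 3)]/(im_k y).
  by apply: quatP; rewrite !mulqE /qi /qj /qk !quatE; ring.
rewrite E => y.
have cc i (p : quat R) : {for y, continuous (fun y : quat R => y 0 i *: p)}.
  apply: (@continuousZ _ _ _ (fun y : quat R => y 0 i : R) (fun=> p)).
    exact: (@coord_continuous _ 1 4 0 i).
  exact: cst_continuous.
exact: (for_continuousD (for_continuousD (for_continuousD (cc _ _) (cc _ _)) (cc _ _)) (cc _ _)).
Qed.

Lemma is_derive_mulq_l (n : nat) (q : quat R) (u : 'rV[R]_n -> quat R) (x v : 'rV[R]_n) :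
  derivable u x v -> is_derive x v (fun y => q * u y) (q * 'D_v u x).
Proof.
move=> du.
have H : (fun h : R => h^-1 *: (((fun y => q * u y) \o shift x) (h *: v) - q * u x))
    @ 0^' --> q * 'D_v u x.
  rewrite (_ : (fun h : R => _) =
     (fun h => q * (h^-1 *: ((u \o shift x) (h *: v) - u x)))); last first.
    by apply/funext => h /=; rewrite -mulrBr scalerAr.
  exact: (@cvg_comp _ _ _ _ (fun y : quat R => q * y) _ _ _ du (@continuous_mulq_l q ('D_v u x))).
apply: DeriveDef; first by apply/cvg_ex; exists (q * 'D_v u x).
exact: cvg_lim H.
Qed.

End SliceCoordinates.

Section SliceDomain.
Variables (R : realType) (D : set (quat R * R)).
Hypotheses (hDC : D `<=` complexes `*` setT)
  (hDsym : forall (z : quat R) (beta : R), D (z, beta) -> D (z, - beta)).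
Local Notation T := 'rV[R]_3.
Local Notation e a := (delta_mx 0 a : 'rV[R]_3).
Implicit Types (I J K q z : quat R) (x : T).

(** An equation z + beta J = z' + beta' J' forces z = z' and beta = beta' or
    beta = - beta'; the symmetry of D takes care of the sign. *)
Lemma OmegaD_point z (beta : R) J : complexes z -> S1 J ->
  OmegaD D (z + beta *: J) <-> D (z, beta).
Proof.
move=> [a [a' ->]] SJ; split; last by move=> Dz; exists (a%:A + a' *: qi), beta, J.
move=> [z' [beta' [J' [Dz' SJ' E]]]].
have [[a1 [a1' /= z'E]] _] := hDC Dz'; rewrite {z'}z'E in Dz' E.
have [b [c [bc JE]]] := S1E SJ; have [b' [c' [bc' JE']]] := S1E SJ'.
rewrite {}JE {}JE' /qi oneqE in E.
have E0 := congr1 (@re R) E; have E1 := congr1 (@im_i R) E.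
have E2 := congr1 (@im_j R) E; have E3 := congr1 (@im_k R) E.
rewrite !quatE !(mulr0, mulr1, add0r, addr0) in E0 E1 E2 E3.
have Dz1 : D (a%:A + a' *: qi, beta') by rewrite E0 E1.
have : beta ^+ 2 = beta' ^+ 2.
  rewrite -[LHS]mulr1 -[RHS]mulr1 -{1}bc -bc' !mulrDr -!exprMn.
  by rewrite E2 E3.
move=> /eqP; rewrite eqf_sqr => /orP[/eqP ->//|/eqP ->]; exact: hDsym.
Qed.

(** Independently of J, this is the set of coordinates of the points of the slice
    of OmegaD D along J. *)
Definition slice_coords : set T :=
  [set x : T | D ((x 0 0)%:A + x 0 1 *: qi, x 0 2)].

Lemma slice_coordsP J x : S1 J ->
  OmegaD D (slice_point J x) <-> slice_coords x.
Proof. by move=> SJ; apply: OmegaD_point => //; exists (x 0 0), (x 0 1). Qed.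

Hypothesis hOmega : slice_domain13 (OmegaD D).

Lemma S1_qj : S1 (qj : quat R).
Proof. by exists 1, 0; rewrite expr1n expr0n addr0 scale1r scale0r addr0. Qed.

Lemma open_slice_coords : open slice_coords.
Proof.
have -> : slice_coords = slice_point qj @^-1` OmegaD D.
  by apply/seteqP; split=> x; rewrite /preimage /= (slice_coordsP x S1_qj).
apply: open_comp; last by case: hOmega => -[].
by move=> x _; exact: continuous_slice_point.
Qed.

Lemma connected_slice_coords : connected slice_coords.
Proof.
pose co (q : quat R) : T := \row_i [:: re q; im_i q; im_j q]`_i.
have -> : slice_coords = co @` slice (OmegaD D) qj.
  apply/seteqP; split=> [x Vx|x [q [Oq [x0 [x1 [x2 qE]]]] <-]].
    exists (slice_point qj x); first split.
    - exact/(slice_coordsP x S1_qj).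
    - by exists (x 0 0), (x 0 1), (x 0 2).
    apply/rowP; apply: ord3P; rewrite !mxE /= /slice_point /qi /qj oneqE !quatE; ring.
  apply/(slice_coordsP _ S1_qj).
  rewrite (_ : slice_point qj (co q) = q)//.
  rewrite qE /slice_point !mxE /= /qi /qj oneqE.
  by apply: quatP; rewrite !quatE; ring.
apply: connected_continuous_connected.
  by case: hOmega => _ _; apply; exact: S1_qj.
apply: continuous_subspaceT => q; apply: continuous_rV; apply: ord3P.
- rewrite (_ : (fun y => _) = (fun y : quat R => re y)); last by apply/funext => y; rewrite mxE.
  exact: (@coord_continuous _ 1 4).
- rewrite (_ : (fun y => _) = (fun y : quat R => im_i y)); last by apply/funext => y; rewrite mxE.
  exact: (@coord_continuous _ 1 4).
- rewrite (_ : (fun y => _) = (fun y : quat R => im_j y)); last by apply/funext => y; rewrite mxE.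
  exact: (@coord_continuous _ 1 4).
Qed.

Lemma slice_coords_plane : exists2 p, slice_coords p & p 0 2 = 0.
Proof.
have [_ [q [Oq [a [a' qE]]]] _] := hOmega.
pose p : T := \row_i [:: a; a'; 0]`_i.
exists p; last by rewrite mxE.
apply/(slice_coordsP p S1_qj).
by rewrite /slice_point !mxE /= scale0r addr0 -qE.
Qed.

Variable f : quat R -> quat R.
Hypothesis hf : regular13 (OmegaD D) f.

Lemma slice_function_C1 J : S1 J ->
  C1 slice_coords (fun x => f (slice_point J x)) /\
  forall x, slice_coords x ->
   'D_(e 0) (fun x => f (slice_point J x)) x +
   qi * 'D_(e 1) (fun x => f (slice_point J x)) x +
   J * 'D_(e 2) (fun x => f (slice_point J x)) x = 0.
Proof.
move=> SJ; have [C1f Df] := hf SJ; have [p0 p1 p2] := slice_point_delta J.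
have inS x : slice_coords x -> slice (OmegaD D) J (slice_point J x).
  by move=> Vx; split; [exact/(slice_coordsP x SJ)|exists (x 0 0), (x 0 1), (x 0 2)].
have dirs : forall i : 'I_3, [set 1; qi; J] (slice_point J (e i)).
  by apply: ord3P; rewrite ?p0 ?p1 ?p2 /=; tauto.
have H i x : slice_coords x -> is_derive x (e i) (fun y => f (slice_point J y))
    ('D_(slice_point J (e i)) f (slice_point J x)).
  by move=> Vx; apply: is_derive_slice; have [d _] := C1f _ (dirs i); apply: d; exact: inS.
split.
  apply: (@C1I R 3 (quat R) _ _ (fun i x => 'D_(slice_point J (e i)) f (slice_point J x))
    open_slice_coords H).
  move=> i x Vx; have [_ c] := C1f _ (dirs i).
  exact: (continuous_within_slice open_slice_coords inS c Vx).
move=> x Vx.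
have [_ ->] := H 0 x Vx; have [_ ->] := H 1 x Vx; have [_ ->] := H 2 x Vx.
by rewrite p0 p1 p2; apply: Df; exact: inS.
Qed.

End SliceDomain.

(** * The representation formula *)

Lemma add_regroup3 (U : nmodType) (a b c a' b' c' a'' b'' c'' : U) :
  a + (b + c) + (a' + (b' + c')) + (a'' + (b'' + c'')) =
  (a + a' + a'') + ((b + b' + b'') + (c + c' + c'')).
Proof. by rewrite (addrACA a) (addrACA b) (addrACA (a + a')) (addrACA (b + b')). Qed.

Section RepresentationAlgebra.
Variable R : realType.
Local Notation T := 'rV[R]_3.
Local Notation e a := (delta_mx 0 a : 'rV[R]_3).
Implicit Types (I J K q z : quat R).

Lemma S1_sqr J : S1 J -> J * J = -1.
Proof.
move=> /S1E [b [c [bc ->]]].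
have -> : -1 = - (b ^+ 2 + c ^+ 2) *: (1 : quat R) by rewrite bc scaleN1r.
by apply: quatP; rewrite oneqE !mulqE !(quatE, quatNE); ring.
Qed.

(** Both products of elements of the span of j and k lie in the span of 1 and i. *)
Lemma S1_sub_inv_comm I J K L : S1 I -> S1 J -> S1 K -> S1 L ->
  qi * ((J - K)^-1 * L + I * (J - K)^-1) = ((J - K)^-1 * L + I * (J - K)^-1) * qi.
Proof.
move=> /S1E [b0 [c0 [_ ->]]] /S1E [b [c [_ ->]]] /S1E [b' [c' [_ ->]]].
move=> /S1E [b1 [c1 [_ ->]]].
set X := mkquat 0 0 b c - mkquat 0 0 b' c'.
have [p [q ->]] : exists p q : R, X^-1 = mkquat 0 0 p q.
  exists (- (sqnormq X)^-1 * (b - b')), (- (sqnormq X)^-1 * (c - c')).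
  rewrite -[X^-1]/(Defs.invq X) /Defs.invq.
  by apply: quatP; rewrite /conjq /X !(quatE, quatNE); ring.
by apply: quatP; rewrite /qi !mulqE !quatE; ring.
Qed.

Lemma subr_mulVq J K : J <> K -> (J - K)^-1 * (J - K) = 1.
Proof.
move=> JK; have H : J - K \in [pred x | x != 0] by rewrite inE subr_eq0; apply/eqP.
exact: (Defs.mulVq H).
Qed.

Lemma C1_mulq_l (V : set T) q (u : T -> quat R) : open V -> C1 V u ->
  C1 V (fun x => q * u x) /\
  forall i x, V x -> 'D_(e i) (fun y => q * u y) x = q * 'D_(e i) u x.
Proof.
move=> oV Cu.
have H i x : V x -> is_derive x (e i) (fun y => q * u y) (q * 'D_(e i) u x).
  by move=> Vx; have [d _] := Cu i x Vx; exact: (@is_derive_mulq_l R 3 q u x (e i) d).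
split; last by move=> i x Vx; have [_] := H i x Vx.
apply: (@C1I R 3 (quat R) V _ (fun i x => q * 'D_(e i) u x) oV H).
move=> i x Vx; have [_ c] := Cu i x Vx.
apply: (@continuous_comp _ _ _ ('D_(e i) u) (fun y : quat R => q * y)); first exact: c.
exact: continuous_mulq_l.
Qed.

Lemma C1_addq (V : set T) (u v : T -> quat R) : open V -> C1 V u -> C1 V v ->
  C1 V (fun x => u x + v x) /\
  forall i x, V x -> 'D_(e i) (fun y => u y + v y) x = 'D_(e i) u x + 'D_(e i) v x.
Proof.
move=> oV Cu Cv.
have H i x : V x -> is_derive x (e i) (fun y => u y + v y) ('D_(e i) u x + 'D_(e i) v x).
  move=> Vx; have [d _] := Cu i x Vx; have [d' _] := Cv i x Vx.
  exact: (@is_deriveD R T (quat R) u v x (e i) _ _ (derivableP d) (derivableP d')).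
split; last by move=> i x Vx; have [_] := H i x Vx.
apply: (@C1I R 3 (quat R) V _ (fun i x => 'D_(e i) u x + 'D_(e i) v x) oV H).
move=> i x Vx; have [_ c] := Cu i x Vx; have [_ c'] := Cv i x Vx.
exact: (@for_continuousD R T (quat R) ('D_(e i) u) ('D_(e i) v) x c c').
Qed.

(** If P commutes with i and satisfies I P = P J, then left multiplication by P maps
    the solutions of the equation for J to those of the equation for I. *)
Lemma slice_transfer I J P d0 d1 d2 :
  qi * P = P * qi -> d0 + qi * d1 + J * d2 = 0 ->
  P * d0 + qi * (P * d1) + I * (P * d2) = (I * P - P * J) * d2.
Proof.
move=> qP H.
have -> : P * d0 = - (P * qi * d1) - P * J * d2.
  rewrite -!mulrA -opprD -mulrDr -mulrN; congr (_ * _).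
  by apply/eqP; rewrite -addr_eq0 addrA H.
rewrite [qi * (P * d1)]mulrA qP [X in X + I * _ = _]addrAC addNr add0r.
by rewrite mulrBl addrC mulrA.
Qed.

Lemma slice_superposition I J K P Q a0 a1 a2 b0 b1 b2 c0 c1 c2 :
  qi * P = P * qi -> qi * Q = Q * qi -> I * P = P * J -> I * Q = Q * K ->
  a0 + qi * a1 + I * a2 = 0 -> b0 + qi * b1 + J * b2 = 0 ->
  c0 + qi * c1 + K * c2 = 0 ->
  a0 + (P * b0 + Q * c0) + qi * (a1 + (P * b1 + Q * c1)) +
    I * (a2 + (P * b2 + Q * c2)) = 0.
Proof.
move=> qP qQ IP IQ tI tJ tK.
rewrite !mulrDr add_regroup3 tI (slice_transfer I qP tJ) (slice_transfer I qQ tK).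
by rewrite IP IQ !subrr !mul0r !addr0.
Qed.

End RepresentationAlgebra.

Section Representation.
Variables (R : realType) (D : set (quat R * R)).
Hypotheses (hDC : D `<=` complexes `*` setT)
  (hDsym : forall (z : quat R) (beta : R), D (z, beta) -> D (z, - beta)).
Hypothesis hOmega : slice_domain13 (OmegaD D).
Variable f : quat R -> quat R.
Hypothesis hf : regular13 (OmegaD D) f.
Local Notation T := 'rV[R]_3.
Local Notation e a := (delta_mx 0 a : 'rV[R]_3).
Implicit Types (I J K q z : quat R).

(** The difference of the two sides solves the equation for I, and it vanishes on
    the plane, where f(z) is multiplied by (J - K)^-1 (J - K) - 1 = 0. *)
Lemma representation_coords I J K (x : T) : S1 I -> S1 J -> S1 K -> J <> K ->
  slice_coords D x ->
  f (slice_point I x) =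
    ((J - K)^-1 * J + I * (J - K)^-1) * f (slice_point J x)
    - ((J - K)^-1 * K + I * (J - K)^-1) * f (slice_point K x).
Proof.
move=> SI SJ SK JK Vx.
set A := (J - K)^-1; pose V := slice_coords D.
have oV : open V := open_slice_coords hDC hDsym hOmega.
have [CI DI] := slice_function_C1 hDC hDsym hOmega hf SI.
have [CJ DJ] := slice_function_C1 hDC hDsym hOmega hf SJ.
have [CK DK] := slice_function_C1 hDC hDsym hOmega hf SK.
pose P := - (A * J + I * A); pose Q := A * K + I * A.
have [CP DP] := C1_mulq_l P oV CJ.
have [CQ DQ] := C1_mulq_l Q oV CK.
have [CPQ DPQ] := C1_addq oV CP CQ.
have [Cg Dg] := C1_addq oV CI CPQ.
pose g (y : T) : quat R := f (slice_point I y) +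
  (P * f (slice_point J y) + Q * f (slice_point K y)).
suff g0 : g x = 0.
  move: g0; rewrite /g /P /Q mulNr => /eqP; rewrite addr_eq0 => /eqP ->.
  by rewrite opprD opprK.
have [b [c [bc IE]]] := S1E SI.
have AJK : A * J - A * K = 1 by rewrite -mulrBr subr_mulVq.
apply: (monogenic_identity bc oV (connected_slice_coords hDC hDsym hOmega) Cg _
  (slice_coords_plane hDC hDsym hOmega) _ Vx).
- move=> y Vy; rewrite /dirac -IE !Dg// !DPQ// !DP// !DQ//.
  have tI := DI y Vy; have tJ := DJ y Vy; have tK := DK y Vy.
  have qP : qi * P = P * qi by rewrite /P mulrN mulNr S1_sub_inv_comm.
  have qQ : qi * Q = Q * qi by rewrite /Q S1_sub_inv_comm.
  have commute L : S1 L -> I * (A * L + I * A) = (A * L + I * A) * L.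
    move=> SL; rewrite mulrDr mulrDl !mulrA (S1_sqr SI) -(mulrA A L) (S1_sqr SL).
    by rewrite mulN1r mulrN1 addrC.
  have IP : I * P = P * J by rewrite /P mulrN mulNr commute.
  exact: (slice_superposition qP qQ IP (commute K SK) tI tJ tK).
- move=> y Vy y2.
  have E L : slice_point L y = slice_point I y by rewrite /slice_point y2 !scale0r.
  rewrite (E J) (E K) -mulrDl -[X in X + _]mul1r -mulrDl /P /Q.
  by rewrite opprD addrACA addNr addr0 [- _ + _]addrC -opprB AJK subrr mul0r.
Qed.

End Representation.

Theorem theorem4p15 (R : realType) (D : set (quat R * R))
    (hDC : D `<=` complexes `*` setT)
    (hDsym : forall (z : quat R) (beta : R), D (z, beta) -> D (z, - beta))
    (hOmega : slice_domain13 (OmegaD D))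
    (f : quat R -> quat R) (hf : regular13 (OmegaD D) f) :
  (forall I J K : quat R, S1 I -> S1 J -> S1 K -> J <> K ->
   forall (z : quat R) (beta : R), complexes z -> OmegaD D (z + beta *: I) ->
     f (z + beta *: I)
       = (J - K)^-1 * (J * f (z + beta *: J) - K * f (z + beta *: K))
         + I * (J - K)^-1 * (f (z + beta *: J) - f (z + beta *: K))
     /\
     f (z + beta *: I)
       = ((J - K)^-1 * J + I * (J - K)^-1) * f (z + beta *: J)
         - ((J - K)^-1 * K + I * (J - K)^-1) * f (z + beta *: K))
  /\
  (forall I J : quat R, S1 I -> S1 J ->
   forall (z : quat R) (beta : R), complexes z -> OmegaD D (z + beta *: I) ->
     f (z + beta *: I)
       = 2^-1 *: (f (z + beta *: J) + f (z - beta *: J))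
         + I * (2^-1 *: J) * (f (z - beta *: J) - f (z + beta *: J))
     /\
     f (z + beta *: I)
       = (2^-1 *: (1 - I * J)) * f (z + beta *: J)
         + (2^-1 *: (1 + I * J)) * f (z - beta *: J)).
Proof.
have rep (I J K z : quat R) (beta : R) : S1 I -> S1 J -> S1 K -> J <> K ->
    complexes z -> OmegaD D (z + beta *: I) ->
    f (z + beta *: I) = ((J - K)^-1 * J + I * (J - K)^-1) * f (z + beta *: J)
      - ((J - K)^-1 * K + I * (J - K)^-1) * f (z + beta *: K).
  move=> SI SJ SK JK zC; rewrite (OmegaD_point hDC hDsym)//.
  case: zC => a [a' ->] Dz.
  pose x : 'rV[R]_3 := \row_i [:: a; a'; beta]`_i.
  have E L : a%:A + a' *: qi + beta *: L = slice_point L x.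
    by rewrite /slice_point !mxE.
  rewrite !E; apply: (representation_coords hDC hDsym hOmega hf SI SJ SK JK).
  by rewrite /slice_coords /mkset !mxE.
split=> [I J K SI SJ SK JK z beta zC Oz|I J SI SJ z beta zC Oz].
  rewrite (rep I J K z beta)//; split => //.
  rewrite !mulrDl !mulrBr !mulrA opprD -!addrA; congr (_ + _).
  by rewrite addrCA.
have SN : S1 (- J).
  have [b [c [bc ->]]] := SJ; exists (- b), (- c).
  by rewrite !sqrrN; split => //; rewrite opprD !scaleNr.
have JJ := S1_sqr SJ.
have half2 (q : quat R) : 2^-1 *: (q + q) = q.
  have H : 2^-1 + 2^-1 = 1 :> R by field.
  by rewrite scalerDr -scalerDl H scale1r.
(* The second formula is the first one with K = - J. *)
have JN : J <> - J.
  move=> H; have J0 : J = 0 by rewrite -[LHS]half2 {2}H subrr scaler0.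
  by move: JJ; rewrite J0 mul0r => /eqP; rewrite eq_sym oppr_eq0 oner_eq0.
have inv : (J - - J)^-1 = 2^-1 *: (- J).
  have V := subr_mulVq JN.
  have W : (J - - J) * (2^-1 *: (- J)) = 1.
    by rewrite opprK -scalerAr mulrN mulrDl JJ opprD !opprK half2.
  by rewrite -[LHS]mulr1 -W mulrA V mul1r.
have coefJ : (J - - J)^-1 * J + I * (J - - J)^-1 = 2^-1 *: (1 - I * J).
  by rewrite inv -scalerAl -scalerAr -scalerDr mulNr JJ opprK mulrN.
have coefN : (J - - J)^-1 * - J + I * (J - - J)^-1 = - (2^-1 *: (1 + I * J)).
  by rewrite inv -scalerAl -scalerAr -scalerDr mulrNN JJ mulrN -opprD scalerN.
have second : f (z + beta *: I) = (2^-1 *: (1 - I * J)) * f (z + beta *: J)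
    + (2^-1 *: (1 + I * J)) * f (z - beta *: J).
  by rewrite (rep I J (- J) z beta)// coefJ coefN mulNr opprK scalerN.
split => //; rewrite second.
rewrite -scalerAr -!scalerAl -!scalerDr; congr (_ *: _).
rewrite mulrBl mulrDl !mul1r mulrBr.
by rewrite addrACA [X in _ + X]addrC.
Qed.
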